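(* Let $n \ge 2$ be an integer. We have $$\mathrm{Cap}_{n,1}(\{x\})=n^n \Omega_n>0$$ for every $x \in \mathbf{R}^n$.
   Context: $\Omega_n=|B(0,1)|$ is the Lebesgue measure of the unit ball of $\mathbf{R}^n$. Functions are real-valued unless stated otherwise. Lorentz spaces. For measurable $f:\mathbf{R}^n\to\mathbf{R}$, let $\lambda_{[f]}(t)=|\{x:|f(x)|>t\}|$, $t\ge 0$, and $f^*(t)=\inf\{v\ge 0:\lambda_{[f]}(v)\le t\}$, $f^{**}(t)=\frac1t\int_0^t f^*(s)\,ds$. Define $\|f\|_{L^{n,1}(\mathbf{R}^n)}=\int_0^\infty t^{1/n}f^*(t)\,\frac{dt}{t}$ and the equivalent norm $\|f\|_{L^{(n,1)}(\mathbf{R}^n)}=\int_0^\infty t^{1/n}f^{**}(t)\,\frac{dt}{t}$. For vector-valued $f$, the norm of $f$ is the norm of the Euclidean length $|f|$. Sobolev-Lorentz spaces. $H^{1,(n,1)}(\mathbf{R}^n)$ is the completion of $\{\phi\in C^\infty(\mathbf{R}^n):\|\phi\|_{H^{1,(n,1)}(\mathbf{R}^n)}<\infty\}$ with respect to $\|\phi\|_{H^{1,(n,1)}(\mathbf{R}^n)}=\|\phi\|_{L^{(n,1)}(\mathbf{R}^n)}+\|\nabla\phi\|_{L^{(n,1)}(\mathbf{R}^n;\mathbf{R}^n)}$, and $H_0^{1,(n,1)}(\mathbf{R}^n)$ is the closure of $C_0^\infty(\mathbf{R}^n)$ in it. $\nabla u$ is the distributional gradient. Put $\|u\|_{H^{1,n,1}(\mathbf{R}^n)}=\|u\|_{L^{n,1}(\mathbf{R}^n)}+\|\nabla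 u\|_{L^{n,1}(\mathbf{R}^n;\mathbf{R}^n)}$. Global capacity. For $E\subset\mathbf{R}^n$, $$\mathrm{Cap}_{n,1}(E)=\inf\{\|u\|_{H^{1,n,1}(\mathbf{R}^n)}^n: u\in H_0^{1,(n,1)}(\mathbf{R}^n),\ u\ge 1 \text{ in an open set containing } E\},$$ with the value $\infty$ if there are no such $u$. *)

(* Defs.v *)
From HB Require Import structures.
From mathcomp Require Import all_boot all_order all_algebra.
From mathcomp Require Import all_classical all_reals all_analysis.

Set Implicit Arguments.
Unset Strict Implicit.
Unset Printing Implicit Defensive.

Import Order.TTheory GRing.Theory Num.Theory.
Import numFieldNormedType.Exports.

Local Open Scope classical_set_scope.
Local Open Scope ring_scope.

Definition rV_display : measure_display -> measure_display.
Proof. exact. Qed.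

(* The sigma-algebra generated by the coordinate maps, i.e. the Borel
   sigma-algebra of R^n. *)
Section measurable_rV.
Context {R : realType} (n : nat).

Let coors : 'I_n -> 'rV[R]_n -> R := fun i x => x 0 i.

Let rV_set0 : g_sigma_preimage coors set0.
Proof. exact: sigma_algebra0. Qed.

Let rV_setC A : g_sigma_preimage coors A -> g_sigma_preimage coors (~` A).
Proof. exact: sigma_algebraC. Qed.

Let rV_bigcup (F : _^nat) : (forall i, g_sigma_preimage coors (F i)) ->
  g_sigma_preimage coors (\bigcup_i (F i)).
Proof. exact: sigma_algebra_bigcup. Qed.

HB.instance Definition _ := @isMeasurable.Build
  (rV_display default_measure_display) 'rV[R]_n (g_sigma_preimage coors) rV_set0 rV_setC rV_bigcup.

End measurable_rV.

Section lebesgue_rV.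
Context {R : realType}.

Definition cons_rV n (p : R * 'rV[R]_n) : 'rV[R]_n.+1 :=
  row_mx (p.1%:M : 'rV_1) p.2.

Definition uncons_rV n (x : 'rV[R]_n.+1) : R * 'rV[R]_n :=
  (x 0 0, \row_j x 0 (lift ord0 j)).

Lemma cons_rV0 n (p : R * 'rV[R]_n) : cons_rV p 0 0 = p.1.
Proof.
by rewrite mxE; case: splitP => [k _|k //]; rewrite ord1 mxE eqxx mulr1n.
Qed.

Lemma cons_rVS n (p : R * 'rV[R]_n) j : cons_rV p 0 (lift ord0 j) = p.2 0 j.
Proof.
rewrite mxE; case: splitP => [k|k /= jk]; first by rewrite ord1.
by congr (p.2 0 _); apply/val_inj; case: jk.
Qed.

Lemma cons_rVK n : cancel (@cons_rV n) (@uncons_rV n).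
Proof.
move=> [a y]; rewrite /uncons_rV cons_rV0; congr pair.
by apply/rowP => j; rewrite mxE cons_rVS.
Qed.

Lemma measurable_coord_rV n (i : 'I_n) :
  measurable_fun [set: 'rV[R]_n] (fun x => x 0 i).
Proof.
move=> _ Y mY; rewrite setTI; apply: sub_sigma_algebra => /=.
rewrite -bigcup_seq/=; exists i => /=; first by rewrite mem_index_enum.
by exists Y => //; rewrite setTI.
Qed.

Lemma measurable_fun_rV d (T : measurableType d) n (f : T -> 'rV[R]_n) :
  (forall i, measurable_fun [set: T] (fun x => f x 0 i)) ->
  measurable_fun [set: T] f.
Proof.
move=> mf.
have H : g_sigma_preimage (fun (i : 'I_n) x => f x 0 i) `<=` measurable.
  apply: smallest_sub; first exact: sigma_algebra_measurable.
  case: n => [|n] in f mf *; first by rewrite big_ord0.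
  rewrite -bigcup_mkord_ord; apply: bigcup_sub => i Ii.
  by move=> A [B mB <-]; exact: mf.
move=> _ A mA; apply: H.
rewrite (g_sigma_preimage_comp (fun (i : 'I_n) (x : 'rV[R]_n) => x 0 i) f).
by exists A.
Qed.

Lemma measurable_cons_rV n : measurable_fun setT (@cons_rV n).
Proof.
apply: measurable_fun_rV => i; have [j ->|->] := unliftP ord0 i.
  under eq_fun do rewrite cons_rVS.
  apply: (@measurableT_comp _ _ _ _ _ _ (fun x : 'rV[R]_n => x 0 j)) => //.
  exact: measurable_coord_rV.
rewrite (_ : (fun _ => _) = fst); first exact: measurable_fst.
by apply/funext => p; rewrite cons_rV0.
Qed.

Lemma measurable_uncons_rV n : measurable_fun setT (@uncons_rV n).
Proof.
apply/measurable_fun_pairP; split; first exact: measurable_coord_rV.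
apply: measurable_fun_rV => j; rewrite /uncons_rV /=.
under eq_fun do rewrite mxE.
exact: measurable_coord_rV.
Qed.

(* Lebesgue measure of R^n.+1 from a measure on R^n, along the identification
   R^n.+1 = R * R^n. *)
Section step.
Variables (n : nat) (mu : {sigma_finite_measure set 'rV[R]_n -> \bar R}).

Definition lebesgue_rVS : set 'rV[R]_n.+1 -> \bar R :=
  pushforward (lebesgue_measure \x mu)%E (@cons_rV n).

HB.instance Definition _ := Measure.copy lebesgue_rVS
  (measure_function_pushforward__canonical__measure_function_Measure
    (lebesgue_measure \x mu)%E (@measurable_cons_rV n)).

Let sigma_finite_lebesgue_rVS : sigma_finite setT lebesgue_rVS.
Proof.
have /sigma_finiteP[F [TF ndF Foo]] := sigma_finiteT (@lebesgue_measure R).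
have /sigma_finiteP[G [TG ndG Goo]] := sigma_finiteT mu.
exists (fun k => @uncons_rV n @^-1` (F k `*` G k)).
  apply/esym/seteqP; split=> // x _.
  have : [set: R] (uncons_rV x).1 by [].
  have : [set: 'rV[R]_n] (uncons_rV x).2 by [].
  rewrite {1}TF {1}TG => -[l _ Gl] [k _ Fk]; exists (maxn k l) => //; split.
  - by move: Fk; exact/subsetPset/ndF/leq_maxl.
  - by move: Gl; exact/subsetPset/ndG/leq_maxr.
move=> k; have [mFk Fk] := Foo k; have [mGk Gk] := Goo k; split.
  rewrite -[X in measurable X]setTI.
  by apply: measurable_uncons_rV => //; exact: measurableX.
rewrite /lebesgue_rVS /pushforward -comp_preimage.
rewrite (_ : _ \o _ = id); last by apply/funext => p /=; rewrite cons_rVK.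
by rewrite preimage_id product_measure1E// lte_mul_pinfty// ge0_fin_numE.
Qed.

HB.instance Definition _ := Measure_isSigmaFinite.Build _ _ _ lebesgue_rVS
  sigma_finite_lebesgue_rVS.

End step.

(* n-dimensional Lebesgue measure on Borel sets: the n-fold product of
   [lebesgue_measure]. *)
Fixpoint lebesgue_rV (n : nat) : {sigma_finite_measure set 'rV[R]_n -> \bar R} :=
  match n with
  | 0%N => dirac (0 : 'rV[R]_0)
  | m.+1 => lebesgue_rVS (lebesgue_rV m)
  end.

End lebesgue_rV.

Section lorentz.
Local Open Scope ereal_scope.
Context {R : realType} {n : nat}.
Implicit Types f : 'rV[R]_n -> R.

Definition distribution_fun f (t : R) : \bar R :=
  lebesgue_rV n [set x | (t < `|f x|)%R].

Definition rearrangement f (t : R) : \bar R :=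
  ereal_inf [set v%:E | v in
    [set v : R | (0 <= v)%R /\ distribution_fun f v <= t%:E]].

Definition max_rearrangement f (t : R) : \bar R :=
  (t^-1)%:E * \int[lebesgue_measure]_(s in `]0%R, t[) rearrangement f s.

(* The norm of L^{n,1}(R^n). *)
Definition lorentz_norm f : \bar R :=
  \int[lebesgue_measure]_(t in `]0%R, +oo[)
    ((t `^ n%:R^-1 / t)%:E * rearrangement f t).

(* The norm of L^{(n,1)}(R^n). *)
Definition lorentz_max_norm f : \bar R :=
  \int[lebesgue_measure]_(t in `]0%R, +oo[)
    ((t `^ n%:R^-1 / t)%:E * max_rearrangement f t).

End lorentz.

(* The norm [`|x|] of the library on row vectors is the maximum norm. *)
Definition eucl_norm {R : realType} {n : nat} (x : 'rV[R]_n) : R :=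
  Num.sqrt (\sum_i x 0 i ^+ 2).

Definition unit_ball_volume (R : realType) (n : nat) : R :=
  fine (lebesgue_rV n [set x : 'rV[R]_n | eucl_norm x < 1]).

Section smooth.
Context {R : realType} {n : nat}.
Implicit Types f : 'rV[R]_n -> R.

Definition partial (i : 'I_n) f : 'rV[R]_n -> R :=
  fun x => 'D_(delta_mx 0 i) f x.

Definition smooth f : Prop :=
  forall s : seq 'I_n, let g := foldr partial f s in
    continuous g /\ forall i x, derivable g x (delta_mx 0 i).

Definition test_function f : Prop :=
  smooth f /\ compact (closure [set x | f x != 0]).

Definition grad f (x : 'rV[R]_n) : 'rV[R]_n := \row_i partial i f x.

End smooth.

Section sobolev_lorentz.
Local Open Scope ereal_scope.
Context {R : realType} {n : nat}.
Implicit Types (u : 'rV[R]_n -> R) (g : 'rV[R]_n -> 'rV[R]_n).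

Definition loc_integrable u : Prop :=
  measurable_fun setT u /\
  forall K, compact K -> (lebesgue_rV n).-integrable K (EFin \o u).

Definition distributional_gradient u g : Prop :=
  [/\ loc_integrable u,
      forall i, loc_integrable (fun x => g x 0%R i)
    & forall (phi : 'rV[R]_n -> R) i, test_function phi ->
        \int[lebesgue_rV n]_x (u x * partial i phi x)%:E =
        - \int[lebesgue_rV n]_x (g x 0%R i * phi x)%:E].

(* Norms of a function u with gradient g. *)
Definition sobolev_max_norm u g : \bar R :=
  lorentz_max_norm u + lorentz_max_norm (@eucl_norm R n \o g).

Definition sobolev_norm u g : \bar R :=
  lorentz_norm u + lorentz_norm (@eucl_norm R n \o g).

Definition sobolev_approx (D : set ('rV[R]_n -> R)) u g : Prop :=
  forall e : R, (0 < e)%R -> exists2 phi, D phi &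
    sobolev_max_norm (fun x => phi x - u x)%R (fun x => grad phi x - g x)%R
    < e%:E.

(* [H1 u g]: u belongs to H^{1,(n,1)}(R^n) and g is its distributional
   gradient.  The abstract completion is realized inside the space of locally
   integrable functions with locally integrable gradient, which is possible
   because L^{(n,1)} is complete and embeds continuously into L^1_loc.
   Functions stand for their classes modulo almost everywhere equality, and
   every class of Lebesgue measurable functions has a Borel representative. *)
Definition H1 u g : Prop :=
  distributional_gradient u g /\
  sobolev_approx
    [set phi | smooth phi /\ sobolev_max_norm phi (grad phi) < +oo] u g.

Definition H1_0 u g : Prop := H1 u g /\ sobolev_approx test_function u g.

(* As u is only defined almost everywhere, u >= 1 in U means a.e. in U. *)
Definition admissible (E : set 'rV[R]_n) u g : Prop :=
  H1_0 u g /\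
  exists U : set 'rV[R]_n, [/\ open U, E `<=` U &
    {ae lebesgue_rV n, forall x, U x -> (1 <= u x)%R}].

(* The value is +oo when there is no admissible u. *)
Definition capacity (E : set 'rV[R]_n) : \bar R :=
  ereal_inf [set c | exists u g, admissible E u g /\ c = sobolev_norm u g ^+ n].

End sobolev_lorentz.

(* Main.v *)
Require Import Defs.
From mathcomp Require Import all_boot all_order all_algebra.
From mathcomp Require Import all_classical all_reals all_analysis.
From mathcomp Require Import measurable_realfun ring lra.

(* Write Om for the volume of the unit ball.

   Upper bound: the cone max(0, r - |x - x0|) / (r (1 - e)), smoothed, is a test
   function which is larger than 1 at x0, hence near x0; its gradient has length
   at most about 1/r on B(x0, r) and vanishes outside, so that the L^{n,1} norm
   of the gradient is at most about (1/r) n (r^n Om)^{1/n} = n Om^{1/n}, while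
   the norm of the function itself is of order r.

   Lower bound: averaging the fundamental theorem of calculus over all rays
   issued from z gives, for a test function phi,
     Om |phi(z)| <= (1/n) \int |grad phi (z + y)| |y|^{1-n} dy,
   and the bathtub principle (the integral of |y|^{1-n} over a set of given
   volume is largest for a centered ball) bounds the right-hand side by
   Om^{1 - 1/n} ||grad phi||_{n,1} / n.  Thus the supremum of |phi| is at most
   ||grad phi||_{n,1} / (n Om^{1/n}).  An admissible u is approximated by such
   phi with gradients close in norm, and exceeds 1 on a set of positive
   measure. *)

Set Implicit Arguments.
Unset Strict Implicit.
Unset Printing Implicit Defensive.

Import Order.TTheory GRing.Theory Num.Theory.
Import numFieldNormedType.Exports.

Local Open Scope classical_set_scope.
Local Open Scope ring_scope.

(** * Powers on the half-line *)

(** Three difficulties shape the lower bound. An admissible function is defined only almost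
    everywhere and its gradient only in the distributional sense, so pointwise arguments take place
    on a nearby test function [phi], and the condition [1 <= u] reaches [phi] only at some point of
    the open set, up to a small loss. The rearrangement is not subadditive, so the gradient of [phi]
    is split into [g] and an error while still integrated against the kernel, and the two pieces are
    rearranged separately. Finally, polar coordinates are replaced by Tonelli and dilations of the
    solid ball: the kernel and the bathtub bound both come from writing a negative power of |y| as
    an integral over r > |y|.

    The two bounds meet because a cone has a gradient of constant length on a ball centred at its
    vertex, the case of equality in the bathtub principle. *)

Section integral_1D.
Context {R : realType}.
Notation mu := (@lebesgue_measure R).

Local Open Scope ereal_scope.

(* Unlike [ge0_le_integral], no measurability is needed. *)
Lemma ge0_integral_le d (T : measurableType d) (m : {measure set T -> \bar R})
    (D : set T) (f g : T -> \bar R) :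
  (forall x, D x -> 0 <= f x) -> (forall x, D x -> f x <= g x) ->
  \int[m]_(x in D) f x <= \int[m]_(x in D) g x.
Proof.
move=> f0 fg; have g0 x : D x -> 0 <= g x.
  by move=> Dx; exact: le_trans (f0 x Dx) (fg x Dx).
rewrite !ge0_integralE//; apply: ereal_sup_le => _ [h /= hf <-].
by exists h => // x; apply: le_trans (hf x) _; exact: lee_restrict.
Qed.

Lemma is_derive_powR_div (a x : R) : a != 0%R -> (0 < x)%R ->
  is_derive x 1%R (fun t => t `^ a / a)%R (x `^ (a - 1))%R.
Proof.
move=> a0 x0.
have -> : (fun t => t `^ a / a)%R = (a^-1 *: (@powR R ^~ a)).
  by apply/funext => t; rewrite /GRing.scale/= mulrC.
have h := is_derive1_powR a x0.
apply: is_derive_eq.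
by rewrite /GRing.scale/= mulrA mulVf// mul1r.
Qed.

Lemma continuous_powR_gt0 (a x : R) : (0 < x)%R -> {for x, continuous (@powR R ^~ a)}.
Proof.
move=> x0; apply: differentiable_continuous; apply/derivable1_diffP.
by apply: derivable_powR; rewrite in_itv/= x0.
Qed.

Lemma powR_itvcc (a b V : R) : (0 < b)%R -> (b < V)%R -> a != 0%R ->
  \int[mu]_(t in `[b, V]) (t `^ (a - 1))%:E = (V `^ a / a - b `^ a / a)%:E.
Proof.
move=> b0 bV a0.
have V0 := lt_trans b0 bV.
have dF x : (0 < x)%R -> derivable (fun t => t `^ a / a)%R x 1%R.
  by move=> x0; case: (is_derive_powR_div a0 x0).
have cF x : (0 < x)%R -> {for x, continuous (fun t => t `^ a / a)%R}.
  by move=> x0; apply: differentiable_continuous; apply/derivable1_diffP; exact: dF.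
rewrite (@continuous_FTC2 R _ (fun t => t `^ a / a)%R)//.
- apply: continuous_in_subspaceT => x /[!inE]/= /[!in_itv]/= /andP[bx _].
  by apply: continuous_powR_gt0; exact: lt_le_trans bx.
- split.
  + by move=> x /[!in_itv]/= /andP[bx _]; apply: dF; exact: lt_trans bx.
  + by apply: cvg_at_right_filter; exact: cF.
  + by apply: cvg_at_left_filter; exact: cF.
- move=> x /[!in_itv]/= /andP[bx _].
  by rewrite derive1E; apply: derive_val; apply: is_derive_powR_div => //; exact: lt_trans bx.
Qed.

Lemma powR_cvgy (a : R) : (a < 0)%R -> (t `^ a)%R @[t --> +oo%R] --> (0:R)%R.
Proof.
move=> a0; have a0' : (0 < - a)%R by rewrite oppr_gt0.
apply/cvgr0Pnorm_le => e e0; near=> t.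
have t0 : (0 < t)%R by near: t; exact: nbhs_pinfty_gt.
rewrite ger0_norm ?powR_ge0// -[a]opprK powRN -[e]invrK lef_pV2 ?posrE ?invr_gt0 ?powR_gt0//.
have h : (e^-1 `^ (- a)^-1 <= t)%R by near: t; exact: nbhs_pinfty_ge.
rewrite -[leLHS](@powRr1 R) ?invr_ge0 ?(ltW e0)//.
rewrite -(@mulVf _ (- a)%R) ?gt_eqF// powRrM.
by apply: ge0_ler_powR => //; rewrite ?nnegrE ?powR_ge0 ?(ltW t0) ?(ltW a0').
Unshelve. all: by end_near. Qed.

Lemma measurable_powR_itv (a : R) (D : set R) : measurable D ->
  measurable_fun D (fun t : R => (t `^ a)%:E).
Proof.
by move=> mD; apply/measurable_EFinP; apply: measurable_funS (measurable_powR a).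
Qed.

(** For a < 1 the integrand is unbounded near 0, so the fundamental theorem of calculus is applied
    on [[b k, V]] and monotone convergence lets [b k] decrease to 0. *)
Lemma integral_powR_oo (a V : R) : (0 < a)%R -> (0 < V)%R ->
  \int[mu]_(t in `]0%R, V[) (t `^ (a - 1))%:E = (V `^ a / a)%:E.
Proof.
move=> a0 V0.
rewrite integral_itv_bndo_bndc; last exact: measurable_powR_itv.
(* Starting at V/2 keeps [b k < V] for every [k], as [powR_itvcc] requires. *)
pose b k : R := (V * k.+2%:R^-1)%R.
have b0 k : (0 < b k)%R by rewrite mulr_gt0// invr_gt0.
have bV k : (b k < V)%R by rewrite gtr_pMr// invf_lt1// ltr1n.
have bcvg : b k @[k --> \oo] --> 0%R.
  rewrite -[X in _ --> X](mulr0 V); apply: cvgM; first exact: cvg_cst.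
  by have := @cvg_harmonic R; rewrite -cvg_shiftS.
have -> : `]0%R, V]%classic = \bigcup_k `[b k, V]%classic.
  apply/seteqP; split => [x /=|x [k _] /=]; rewrite !in_itv/= => /andP[x0 xV].
    near \oo => k; exists k => //=; rewrite in_itv/= xV andbT.
    by near: k; apply: (cvgr_le _ bcvg).
  by rewrite xV (lt_le_trans (b0 k)).
have h1 : \int[mu]_(t in `[b k, V]) (t `^ (a - 1))%:E @[k --> \oo] -->
   \int[mu]_(t in \bigcup_k `[b k, V]%classic) (t `^ (a - 1))%:E.
  apply: ge0_nondecreasing_set_cvg_integral => //.
  - move=> k l kl; rewrite subsetEset; apply: subset_itvr; rewrite bnd_simp.
    by rewrite ler_pM2l// lef_pV2 ?posrE ?ler_nat.
  - by move=> i; exact: measurable_powR_itv.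
  - by move=> i x _; rewrite lee_fin powR_ge0.
have h2 : \int[mu]_(t in `[b k, V]) (t `^ (a - 1))%:E @[k --> \oo] --> (V `^ a / a)%:E.
  under eq_fun do rewrite powR_itvcc ?gt_eqF//.
  apply/fine_cvgP; split; first by near=> k.
  rewrite -[X in _ --> X]subr0; apply: cvgB; first exact: cvg_cst.
  rewrite -[X in _ --> X](mul0r a^-1%R); apply: cvgM; last exact: cvg_cst.
  by have /cvg_at_rightP := powR_cvg0 a0; apply; split.
exact: (cvg_unique _ h1 h2).
Unshelve. all: by end_near. Qed.

Lemma integral_powR_y (a c : R) : (a < 0)%R -> (0 < c)%R ->
  \int[mu]_(t in `[c, +oo[) (t `^ (a - 1))%:E = (c `^ a / - a)%:E.
Proof.
move=> a0 c0; have aneq0 : a != 0%R by rewrite lt_eqF.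
have dF x : (0 < x)%R -> derivable (fun t => t `^ a / a)%R x 1%R.
  by move=> x0; case: (is_derive_powR_div aneq0 x0).
have cF : {for c, continuous (fun t => t `^ a / a)%R}.
  by apply: differentiable_continuous; apply/derivable1_diffP; exact: dF.
rewrite (@ge0_continuous_FTC2y R _ (fun t => t `^ a / a)%R _ 0%R)//.
- by rewrite -EFinB sub0r invrN mulrN.
- by move=> x _; exact: powR_ge0.
- apply: continuous_in_subspaceT => x /[!inE]/= /[!in_itv]/= /andP[bx _].
  by apply: continuous_powR_gt0; exact: lt_le_trans bx.
- rewrite -[X in _ --> X](mul0r a^-1%R); apply: cvgM; last exact: cvg_cst.
  exact: powR_cvgy.
- by move=> x cx; apply: dF; exact: lt_trans cx.
- by apply: cvg_at_right_filter; exact: cF.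
- move=> x /[!in_itv]/= /andP[bx _].
  by rewrite derive1E; apply: derive_val; apply: is_derive_powR_div => //; exact: lt_trans bx.
Qed.

End integral_1D.

(** * Lebesgue measure on row vectors *)

Section measure_rV.
Context {R : realType}.
Notation mu := (@lebesgue_measure R).

Lemma measurable_set_coord n (i : 'I_n) (I : set R) : measurable I ->
  measurable [set x : 'rV[R]_n | I (x 0 i)].
Proof. by move=> mI; rewrite -[X in measurable X]setTI; exact: measurable_coord_rV. Qed.

Lemma measurable_box n (I : 'I_n -> set R) : (forall i, measurable (I i)) ->
  measurable [set x : 'rV[R]_n | forall i, I i (x 0 i)].
Proof.
move=> mI; have -> : [set x : 'rV[R]_n | forall i, I i (x 0 i)] =
    \bigcap_(i in [set: 'I_n]) [set x : 'rV[R]_n | I i (x 0 i)].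
  by apply/seteqP; split => x /= h i; [move=> _; exact: h|exact: h].
apply: fin_bigcap_measurable => //= i _; exact: measurable_set_coord.
Qed.

(** The sigma-algebra is generated by the coordinates, not by the topology. An open set is the union
    of the open cubes contained in it with rational centre and half-edge 1/(k+1), and these are
    countably many. *)
Lemma open_measurable_rV n (U : set 'rV[R]_n) : open U -> measurable U.
Proof.
move=> oU.
pose B (p : 'rV[rat]_n * nat) : set 'rV[R]_n :=
  [set x | forall i, ball (ratr (p.1 0 i) : R) p.2.+1%:R^-1 (x 0 i)].
have -> : U = \bigcup_p (if `[< B p `<=` U >] then B p else set0).
  apply/seteqP; split => [x Ux|x [p _]]; last by case: ifPn => // /asboolP pU /pU.
  have : nbhs x U by exact: open_nbhs_nbhs.
  move=> /nbhs_ballP[e /= e0 eU].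
  (* The factor 2 pays for two steps of the triangle inequality: from [x] to the rational centre,
     and from there to any point of the cube. *)
  have [k ke] : exists k : nat, 2 * k.+1%:R^-1 <= e.
    near \oo => k; exists k.
    rewrite ler_pdivrMr// mulrC -ler_pdivrMr//.
    rewrite (@le_trans _ _ k%:R)// ?ler_nat//.
    by near: k; exact: nbhs_infty_ger.
  have k0 : (0 < k.+1%:R^-1 :> R) by rewrite invr_gt0.
  have /choice[q hq] : forall i, exists q : rat, ball (x 0 i) k.+1%:R^-1 (ratr q : R).
    move=> i; have xx : x 0 i - k.+1%:R^-1 < x 0 i + k.+1%:R^-1 :> R.
      by rewrite ltrD2l (lt_trans _ k0)// oppr_lt0.
    have [q] := rat_in_itvoo xx.
    by rewrite in_itv/= => qh; exists q; rewrite /ball/= distrC ltr_distl.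
  exists (\row_i q i, k) => //; rewrite asboolT => [i /=|y /= By].
    by rewrite mxE; exact/ball_sym.
  apply: eU; split => // i j; rewrite (ord1 i).
  apply: (le_ball ke); have := By j; rewrite mxE.
  have -> : 2 * k.+1%:R^-1 = k.+1%:R^-1 + k.+1%:R^-1 :> R by rewrite mulr_natl mulr2n.
  by apply: ball_triangle; exact: hq.
apply: countable_bigcupT_measurable => [|p]; first exact: countableP.
case: ifPn => // _.
apply: (@measurable_box _ (fun i => ball (ratr (p.1 0 i) : R) p.2.+1%:R^-1)) => i.
by apply: open_measurable; exact: ball_open.
Unshelve. all: by end_near. Qed.

Lemma continuous_measurable_rV n (f : 'rV[R]_n -> R) :
  continuous f -> measurable_fun setT f.
Proof.
move=> /continuousP cf; apply: (measurability _ (RGenOpens.measurableE R)).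
move=> _ [_ [a [b ->] <-]]; rewrite setTI; apply: open_measurable_rV.
exact/cf/interval_open.
Qed.

Local Open Scope ereal_scope.

(** The image of Lebesgue measure under [h], multiplied by [c], agrees with Lebesgue measure on the
    intervals []u, v]], hence on all measurable sets by uniqueness. *)
Lemma ge0_integral_affine (a c : R) (f : R -> \bar R) : (0 < c)%R ->
  measurable_fun setT f -> (forall x, 0 <= f x) ->
  \int[mu]_x f (a + c * x)%R = (c^-1)%:E * \int[mu]_x f x.
Proof.
move=> c0 mf f0.
pose h (x : measurableTypeR R) : measurableTypeR R := (a + c * x)%R.
have mh : measurable_fun setT h.
  apply: continuous_measurable_fun => x; apply: cvgD; first exact: cvg_cst.
  by apply: cvgM; [exact: cvg_cst|exact: cvg_id].
have c0' : (0 <= c)%R by exact: ltW.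
have E A : measurable A -> mu A = mscale (NngNum c0') (pushforward mu h) A.
  move=> mA; pose m : {measure set _ -> \bar R} := mscale (NngNum c0')
    (measure_function_pushforward__canonical__measure_function_Measure mu mh).
  apply: (@lebesgue_measure_unique R m) => // X [[u v] _ <-].
  rewrite /m/= /mscale/= /pushforward/=.
  have -> : h @^-1` `]u, v] = `]((u - a) / c)%R, ((v - a) / c)%R]%classic.
    apply/seteqP; split => x /=; rewrite /h !in_itv/= ltr_pdivrMr// ler_pdivlMr//.
      by move=> /andP[? ?]; apply/andP; split; lra.
    by move=> /andP[? ?]; apply/andP; split; lra.
  rewrite !lebesgue_measure_itv/= !lte_fin ltr_pM2r ?invr_gt0//.
  rewrite ltrD2r; case: ifPn => _; last by rewrite mule0.
  by rewrite -!EFinD -EFinM; congr EFin; field; rewrite gt_eqF.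
transitivity (\int[pushforward mu h]_x f x).
  by rewrite ge0_integral_pushforward// preimage_setT.
rewrite [in RHS](eq_measure_integral (mscale (NngNum c0') (pushforward mu h))); last first.
  by move=> A mA _; exact: E.
rewrite ge0_integral_mscale//= muleA -EFinM mulVf ?mul1e// gt_eqF//.
Qed.

Lemma ge0_integral_cons_rV n (f : 'rV[R]_n.+1 -> \bar R) :
  measurable_fun setT f -> (forall x, 0 <= f x) ->
  \int[lebesgue_rV n.+1]_x f x = \int[mu \x lebesgue_rV n]_p f (cons_rV p).
Proof.
move=> mf f0.
have H := @ge0_integral_pushforward _ _ (measurableTypeR R * 'rV[R]_n)%type _ R
  (@cons_rV R n) (@measurable_cons_rV R n) (mu \x lebesgue_rV n) _ f measurableT mf
  (fun y _ => f0 y).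
by rewrite preimage_setT in H; rewrite -H.
Qed.

Lemma ge0_integral_rVS n (f : 'rV[R]_n.+1 -> \bar R) :
  measurable_fun setT f -> (forall x, 0 <= f x) ->
  \int[lebesgue_rV n.+1]_x f x =
  \int[mu]_a \int[lebesgue_rV n]_y f (cons_rV (a, y)).
Proof.
move=> mf f0; transitivity (\int[mu \x lebesgue_rV n]_p (f \o @cons_rV R n) p).
  exact: ge0_integral_cons_rV.
rewrite fubini_tonelli1//.
- exact: measurableT_comp mf (@measurable_cons_rV R n).
- by move=> p; exact: f0.
Qed.

Lemma integrable_cons_rV n (f : 'rV[R]_n.+1 -> \bar R) :
  (lebesgue_rV n.+1).-integrable setT f ->
  (mu \x lebesgue_rV n).-integrable setT (f \o @cons_rV R n).
Proof.
move=> /integrableP[mf fi]; apply/integrableP; split.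
  exact: measurableT_comp mf (@measurable_cons_rV R n).
apply: le_lt_trans fi; rewrite ge0_integral_cons_rV//; exact: measurableT_comp.
Qed.

Lemma integral_cons_rV n (f : 'rV[R]_n.+1 -> \bar R) :
  (lebesgue_rV n.+1).-integrable setT f ->
  \int[lebesgue_rV n.+1]_x f x = \int[mu \x lebesgue_rV n]_p f (cons_rV p).
Proof.
move=> fi; have /integrableP[mf _] := fi.
have H := @integral_pushforward _ _ (measurableTypeR R * 'rV[R]_n)%type _ R
  (@cons_rV R n) (@measurable_cons_rV R n) (mu \x lebesgue_rV n) setT f mf
  (integrable_cons_rV fi) measurableT.
by rewrite preimage_setT in H; rewrite -H.
Qed.

Lemma measurable_affine_rV n (z : 'rV[R]_n) (r : R) :
  measurable_fun setT (fun y : 'rV[R]_n => z + r *: y)%R.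
Proof.
apply: measurable_fun_rV => i; under eq_fun do rewrite !mxE.
by apply: measurable_funD => //; apply: measurable_funM => //; exact: measurable_coord_rV.
Qed.

Lemma affine_cons_rV n (z : 'rV[R]_n.+1) (r a : R) (y : 'rV[R]_n) :
  (z + r *: cons_rV (a, y) =
  cons_rV ((uncons_rV z).1 + r * a, (uncons_rV z).2 + r *: y))%R.
Proof.
apply/rowP => i; have [j ->|->] := unliftP ord0 i.
  by rewrite [LHS]mxE [X in (_ + X)%R]mxE !cons_rVS/= !mxE.
by rewrite [LHS]mxE [X in (_ + X)%R]mxE !cons_rV0.
Qed.

(** Induction on the dimension: by Tonelli the first coordinate contributes one factor 1/r, the
    others the induction hypothesis. *)
Lemma ge0_integral_rV_affine n (z : 'rV[R]_n) (r : R) (f : 'rV[R]_n -> \bar R) :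
  (0 < r)%R -> measurable_fun setT f -> (forall x, 0 <= f x) ->
  \int[lebesgue_rV n]_y f (z + r *: y)%R = (r ^- n)%:E * \int[lebesgue_rV n]_y f y.
Proof.
move=> r0; elim: n z f => [|n IH] z f mf f0.
  rewrite expr0 invr1 mul1e; apply: eq_integral => y _; congr f.
  by apply/rowP => -[].
have mg : measurable_fun [set: 'rV[R]_n.+1] (fun y => f (z + r *: y)%R).
  exact: measurableT_comp mf (measurable_affine_rV z r).
have mfc := measurableT_comp mf (@measurable_cons_rV R n).
pose F a := \int[lebesgue_rV n]_y f (cons_rV (a, y)).
have F0 a : 0 <= F a by exact: integral_ge0.
have mF : measurable_fun setT F.
  exact: (measurable_fun_fubini_tonelli_F (m2 := lebesgue_rV n) _ mfc (fun _ => f0 _)).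
rewrite !ge0_integral_rVS//.
transitivity (\int[mu]_a ((r ^- n)%:E * F ((uncons_rV z).1 + r * a)%R)).
  apply: eq_integral => a _; under eq_integral do rewrite affine_cons_rV.
  rewrite (IH _ (fun y => f (cons_rV (_, y)%R)))//.
  exact: measurableT_comp mfc (measurable_pair1 _).
rewrite ge0_integralZl; last 4 first.
- exact: measurableT.
- apply: measurableT_comp mF _.
  by apply: measurable_funD => //; exact: measurable_funM.
- by move=> a _; exact: F0.
- by rewrite lee_fin invr_ge0 exprn_ge0// ltW.
rewrite (@ge0_integral_affine _ r F r0 mF F0).
by rewrite muleA -EFinM exprS invfM mulrC.
Qed.

Lemma lebesgue_rV_affine n (z : 'rV[R]_n) (r : R) (A : set 'rV[R]_n) :
  (0 < r)%R -> measurable A ->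
  lebesgue_rV n [set y | A (z + r *: y)%R] = (r ^- n)%:E * lebesgue_rV n A.
Proof.
move=> r0 mA; rewrite -[in RHS](setIT A) -integral_indic//.
rewrite -(ge0_integral_rV_affine z)//; last first.
  by apply/measurable_EFinP; exact: measurable_indic.
rewrite -[in LHS](setIT [set y | _]) -integral_indic//.
by rewrite -[X in measurable X]setTI; exact: measurable_affine_rV.
Qed.

Lemma lebesgue_rV_box n (I : set R) : measurable I ->
  lebesgue_rV n [set x : 'rV[R]_n | forall i, I (x 0%R i)] = mu I ^+ n.
Proof.
move=> mI; elim: n => [|n IH].
  by rewrite /= diracE mem_set// => -[].
rewrite [LHS]/= /lebesgue_rVS /pushforward.
have -> : cons_rV (n:=n) @^-1` [set x | forall i, I (x 0%R i)] =
    I `*` [set x : 'rV[R]_n | forall i, I (x 0%R i)].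
  apply/seteqP; split => [[a y]/= h|[a y]/= [Ia Iy] i].
    split => [|i]; first by have := h ord0; rewrite cons_rV0.
    by have := h (lift ord0 i); rewrite cons_rVS.
  by have [j ->|->] := unliftP ord0 i; rewrite ?cons_rVS ?cons_rV0/=.
rewrite product_measure1E//; first by rewrite IH expeS.
exact: (@measurable_box n (fun=> I) (fun=> mI)).
Qed.

End measure_rV.

(** * Euclidean norm, balls and their volumes *)

Section eucl.
Context {R : realType}.

(** Cauchy-Schwarz. With S, T the sums of squares and P the sum of products, the squares (T x_i - P
    y_i)^2 add up to T (S T - P^2). If T = 0, all [y i] vanish. *)
Lemma sum_mul_le_sqrt (I : finType) (x y : I -> R) :
  `|\sum_i x i * y i| <= Num.sqrt (\sum_i x i ^+ 2) * Num.sqrt (\sum_i y i ^+ 2).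
Proof.
set S := \sum_i x i ^+ 2; set T := \sum_i y i ^+ 2; set P := \sum_i x i * y i.
have S0 : 0 <= S by apply: sumr_ge0 => i _; exact: sqr_ge0.
have T0 : 0 <= T by apply: sumr_ge0 => i _; exact: sqr_ge0.
rewrite -sqrtrM// -sqrtr_sqr ler_sqrt ?mulr_ge0//.
have : 0 <= \sum_i (T * x i - P * y i) ^+ 2 by apply: sumr_ge0 => i _; exact: sqr_ge0.
rewrite (eq_bigr (fun i => T ^+ 2 * x i ^+ 2 + (- (2 * T * P)) * (x i * y i)
   + P ^+ 2 * y i ^+ 2)); last by move=> i _; ring.
rewrite !big_split/= -!mulr_sumr -/S -/T -/P => h.
have {}h : 0 <= T * (S * T - P ^+ 2).
  by apply: le_trans h _; rewrite le_eqVlt; apply/orP; left; apply/eqP; ring.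
have [T1|T1] := eqVneq T 0; last first.
  have TT : 0 < T by rewrite lt_def T1.
  by rewrite -subr_ge0 -(pmulr_rge0 _ TT).
have y0 i : y i = 0.
  apply/eqP; rewrite -sqrf_eq0; move/eqP: T1; rewrite psumr_eq0; last by move=> *; exact: sqr_ge0.
  by move=> /allP/(_ i); rewrite mem_index_enum => /(_ isT).
by rewrite /P big1 ?expr0n/= ?mulr_ge0// => i _; rewrite y0 mulr0.
Qed.

Lemma eucl_norm_ge0 n (x : 'rV[R]_n) : 0 <= eucl_norm x.
Proof. exact: sqrtr_ge0. Qed.

Lemma eucl_norm_sqr n (x : 'rV[R]_n) : eucl_norm x ^+ 2 = \sum_i x 0 i ^+ 2.
Proof. by rewrite sqr_sqrtr// sumr_ge0// => i _; exact: sqr_ge0. Qed.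

Lemma eucl_normZ n (r : R) (x : 'rV[R]_n) : eucl_norm (r *: x) = `|r| * eucl_norm x.
Proof.
rewrite /eucl_norm; under eq_bigr do rewrite mxE exprMn.
by rewrite -mulr_sumr sqrtrM ?sqr_ge0// sqrtr_sqr.
Qed.

Lemma eucl_norm0 n : eucl_norm (0 : 'rV[R]_n) = 0.
Proof. by rewrite -(scale0r 0) eucl_normZ normr0 mul0r. Qed.

Lemma ler_eucl_normD n (x y : 'rV[R]_n) :
  eucl_norm (x + y) <= eucl_norm x + eucl_norm y.
Proof.
rewrite -(@ler_pXn2r _ 2) ?nnegrE ?addr_ge0 ?eucl_norm_ge0// sqrrD !eucl_norm_sqr.
under eq_bigr do rewrite mxE sqrrD.
rewrite 2!big_split/= lerD2r lerD2l sumrMnl ler_pMn2r//.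
exact: le_trans (ler_norm _) (sum_mul_le_sqrt _ _).
Qed.

Lemma ler_coord_eucl_norm n (x : 'rV[R]_n) i : `|x 0 i| <= eucl_norm x.
Proof.
rewrite -sqrtr_sqr ler_sqrt ?sumr_ge0// => [|j _]; last exact: sqr_ge0.
by rewrite (bigD1 i)//= lerDl sumr_ge0// => j _; exact: sqr_ge0.
Qed.

Lemma continuous_sum_sqr n : continuous (fun x : 'rV[R]_n => \sum_i x 0 i ^+ 2).
Proof.
apply: continuous_big => [|i _ x]; first exact: add_continuous.
apply: (@continuous_comp _ _ _ (fun x : 'rV[R]_n => x 0 i) (fun a => a ^+ 2)).
  exact: coord_continuous.
exact: exprn_continuous.
Qed.

Lemma continuous_eucl_norm n : continuous (@eucl_norm R n).
Proof.
move=> x; apply: (@continuous_comp _ _ _ (fun x : 'rV[R]_n => \sum_i x 0 i ^+ 2) Num.sqrt).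
  exact: continuous_sum_sqr.
exact: sqrt_continuous.
Qed.

Lemma measurable_eucl_norm n : measurable_fun setT (@eucl_norm R n).
Proof. exact: continuous_measurable_rV (@continuous_eucl_norm n). Qed.

Definition eucl_ball n (r : R) : set 'rV[R]_n := [set y | eucl_norm y < r].

Lemma open_eucl_ball n r : open (@eucl_ball n r).
Proof.
have /continuousP := @continuous_eucl_norm n.
by move=> /(_ [set t | t < r]); apply; exact: open_lt.
Qed.

Lemma measurable_eucl_ball n r : measurable (@eucl_ball n r).
Proof. by apply: open_measurable_rV; exact: open_eucl_ball. Qed.

Lemma eucl_ball_finite n r : (lebesgue_rV n (@eucl_ball n r) < +oo)%E.
Proof.
have [r0|r0] := ltP 0 r; last first.
  rewrite (_ : eucl_ball _ = set0) ?measure0//; apply/seteqP; split => // x /=.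
  by rewrite /eucl_ball/= ltNge (le_trans r0)// eucl_norm_ge0.
have mI : measurable (`[- r, r]%classic : set R) by exact: measurable_itv.
apply: (@le_lt_trans _ _ (lebesgue_rV n [set x : 'rV[R]_n | forall i, `[- r, r]%classic (x 0 i)])).
  apply: le_measure; rewrite ?inE.
  - exact: measurable_eucl_ball.
  - exact: (@measurable_box R n (fun=> `[- r, r]%classic)).
  - move=> x /= xr i; rewrite /= in_itv/= -ler_norml.
    exact: le_trans (ler_coord_eucl_norm _ _) (ltW xr).
rewrite lebesgue_rV_box// lebesgue_measure_itv/= lte_fin gtrN//.
by rewrite -EFinD -EFin_expe ltry.
Qed.

Lemma unit_ball_volumeE n : (unit_ball_volume R n)%:E = lebesgue_rV n (@eucl_ball n 1).
Proof. by rewrite fineK// ge0_fin_numE// eucl_ball_finite. Qed.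

Lemma eucl_ball_volume n r : 0 < r ->
  lebesgue_rV n (@eucl_ball n r) = (r ^+ n * unit_ball_volume R n)%:E.
Proof.
move=> r0; rewrite EFinM unit_ball_volumeE.
have -> : eucl_ball r = [set y : 'rV[R]_n | eucl_ball 1 (0 + r^-1 *: y)].
  apply/seteqP; split => y /=; rewrite /eucl_ball/= add0r eucl_normZ gtr0_norm ?invr_gt0//;
  by rewrite mulrC ltr_pdivrMr// mul1r.
rewrite lebesgue_rV_affine ?invr_gt0//; last exact: measurable_eucl_ball.
by rewrite exprVn invrK.
Qed.

(** The balls of the maximum norm are cubes, so a translate of the cube ]-e, e[^n lies in [U]. *)
Lemma open_lebesgue_rV_gt0 n (U : set 'rV[R]_n) (x : 'rV[R]_n) : open U -> U x ->
  (0 < lebesgue_rV n U)%E.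
Proof.
move=> oU Ux.
have /nbhs_ballP[e /= e0 eU] : nbhs x U by exact: open_nbhs_nbhs.
pose J : set R := `]- e, e[%classic.
have mJ : measurable J by exact: measurable_itv.
have : (0 < lebesgue_rV n [set y : 'rV[R]_n | forall i, J (y 0%R i)])%E.
  rewrite lebesgue_rV_box// lebesgue_measure_itv/= lte_fin gtrN// -EFinD -EFin_expe.
  by rewrite lte_fin exprn_gt0//; lra.
move=> /lt_le_trans; apply.
have mU := open_measurable_rV oU.
have <- : lebesgue_rV n [set y | U (x + 1 *: y)] = lebesgue_rV n U.
  by rewrite lebesgue_rV_affine// expr1n invr1 mul1e.
apply: le_measure; rewrite ?inE.
- exact: (@measurable_box R n (fun=> J)).
- rewrite -[X in measurable X]setTI; apply: measurable_affine_rV => //; exact: open_measurable_rV.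
- move=> y /= ye; apply: eU; split => // i j; rewrite (ord1 i) !mxE mul1r.
  by rewrite /ball/= opprD addNKr normrN ltr_norml; have := ye j; rewrite /J/= in_itv.
Qed.

Lemma unit_ball_volume_gt0 n : 0 < unit_ball_volume R n.
Proof.
rewrite -lte_fin unit_ball_volumeE; apply: (open_lebesgue_rV_gt0 (x := 0)).
  exact: open_eucl_ball.
by rewrite /eucl_ball/= eucl_norm0.
Qed.

(** A point is a cube with edges of length 0. In dimension 0 its measure would be 1. *)
Lemma lebesgue_rV_point0 n : (0 < n)%N -> lebesgue_rV n [set (0 : 'rV[R]_n)] = 0%E.
Proof.
case: n => // n _.
have := @lebesgue_rV_box R n.+1 [set 0] (measurable_set1 _).
rewrite lebesgue_measure_set1 -EFin_expe exprS mul0r => h; rewrite -[RHS]h.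
congr (lebesgue_rV n.+1 _); apply/seteqP; split => [_ -> i /=|x /= x0]; first by rewrite mxE.
by apply/rowP => i; rewrite x0 mxE.
Qed.

End eucl.

(** * Directional derivatives and integration by parts *)

Section directional.
Context {R : realType} {V : normedModType R}.
Implicit Types (f : V -> R) (x y v w : V).

(** Restriction to a line turns a directional derivative into a derivative in one variable, within
    reach of the mean value theorem and the fundamental theorem of calculus. *)
Lemma is_derive_line f y w (t : R) : derivable f (t *: w + y) w ->
  is_derive t (1 : R) (fun s : R => f (s *: w + y)) ('D_w f (t *: w + y)).
Proof.
move=> df.
suff E : (fun h => h^-1 *: (((fun s : R => f (s *: w + y)) \o shift t) (h *: 1)
    - f (t *: w + y))) =
  (fun h => h^-1 *: ((f \o shift (t *: w + y)) (h *: w) - f (t *: w + y))).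
  by split; [rewrite /derivable E|rewrite /derive E].
apply/funext => h /=; congr (_ *: (f _ - _)).
by rewrite [_ *: 1]mulr1 scalerDl addrA.
Qed.

Lemma is_derive_line0 f y w (d : R) : is_derive (0 : R) (1 : R) (fun s : R => f (s *: w + y)) d ->
  is_derive y w f d.
Proof.
suff E : (fun h => h^-1 *: (((fun s : R => f (s *: w + y)) \o shift 0) (h *: 1)
    - f (0 *: w + y))) =
  (fun h => h^-1 *: ((f \o shift y) (h *: w) - f y)).
  by case; rewrite /derivable /derive E => df <-; split.
apply/funext => h /=; rewrite scale0r add0r; congr (_ *: (f _ - _)).
by rewrite [_ *: 1]mulr1 addr0.
Qed.

Lemma is_deriveZ_dir f y w (c : R) : derivable f y w ->
  is_derive y (c *: w) f (c * 'D_w f y).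
Proof.
move=> df; apply: is_derive_line0.
have -> : (fun s : R => f (s *: (c *: w) + y)) =
    (fun s : R => f (s *: w + y)) \o (fun s => c * s).
  by apply/funext => s /=; rewrite scalerA mulrC.
rewrite mulrC; apply: is_derive1_comp.
  rewrite mulr0; have /is_derive_line : derivable f (0 *: w + y) w by rewrite scale0r add0r.
  by rewrite scale0r add0r.
apply: is_derive_eq.
by rewrite /GRing.scale/= mulr1.
Qed.

Lemma mvt_dir f y w (h : R) : (forall z, derivable f z w) ->
  exists2 c : R, `|c| <= `|h| & f (h *: w + y) - f y = h * 'D_w f (c *: w + y).
Proof.
move=> df.
have dg (t : R) : is_derive t (1 : R) (fun s : R => f (s *: w + y)) ('D_w f (t *: w + y)).
  exact: is_derive_line.
have cg (a b : R) : {within `[a, b], continuous (fun s : R => f (s *: w + y))}.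
  apply: derivable_within_continuous => t _.
  by case: (dg t).
have [h0|h0] := leP 0 h.
  have [c] := MVT_segment h0 (fun t _ => dg t) (cg _ _).
  rewrite in_itv/= => /andP[c0 ch]; rewrite scale0r add0r subr0 mulrC => E.
  by exists c => //; rewrite !ger0_norm.
have [c] := MVT_segment (ltW h0) (fun t _ => dg t) (cg _ _).
rewrite in_itv/= => /andP[hc c0]; rewrite scale0r add0r sub0r mulrN => E.
exists c; first by rewrite !ler0_norm ?lerN2// ltW.
by rewrite -[LHS]opprK opprB E opprK mulrC.
Qed.

(** The classical argument by which continuous partial derivatives give all directional ones, one
    direction at a time: the increment along v + w is an increment along [v] followed by one along
    [w], and continuity of ['D_w f] is asked for at [x] alone. *)
Lemma is_deriveD_dir f x v w (a : R) : is_derive x v f a ->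
  (forall z, derivable f z w) -> {for x, continuous ('D_w f)} ->
  is_derive x (v + w) f (a + 'D_w f x).
Proof.
move=> [dv <-] dw cw.
suff H : h^-1 *: ((f \o shift x) (h *: (v + w)) - f x) @[h --> 0^'] -->
    'D_v f x + 'D_w f x.
  by split; [exact: cvgP H|exact: cvg_lim H].
(* Difference quotient along [w] from the moving base point x + h v; by the mean value theorem it is
   a value of ['D_w f] near [x]. *)
pose q h := h^-1 * (f (h *: w + (h *: v + x)) - f (h *: v + x)).
have -> : (fun h => h^-1 *: ((f \o shift x) (h *: (v + w)) - f x)) =
   (fun h => h^-1 *: ((f \o shift x) (h *: v) - f x)) + q.
  apply/funext => h.
  change (h^-1 * (f (h *: (v + w) + x) - f x) = h^-1 * (f (h *: v + x) - f x) +
    h^-1 * (f (h *: w + (h *: v + x)) - f (h *: v + x))).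
  rewrite -mulrDr; congr (_ * _).
  by rewrite scalerDr [h *: v + h *: w]addrC -addrA [RHS]addrC subrKA.
apply: cvgD; first exact: dv.
have := cw; rewrite /continuous_at/= => /cvgrPdist_le cwx.
apply/cvgrPdist_le => e e0.
have /nbhs_ballP[d /= d0 hd] := cwx _ e0.
have D0 : 0 < `|w| + `|v| + 1 by rewrite ltr_wpDl// addr_ge0.
near=> h.
have h0 : h != 0 by near: h; exact: nbhs_dnbhs_neq.
have hs : `|h| < d / (`|w| + `|v| + 1).
  near: h; apply: nbhs_dnbhs.
  by exists (d / (`|w| + `|v| + 1)) => /=; [rewrite divr_gt0|move=> y/=; rewrite sub0r normrN].
have [c ch cE] := mvt_dir (h *: v + x) h dw.
rewrite /q cE mulKf//; apply: hd.
rewrite -ball_normE/= distrC addrA addrK.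
apply: le_lt_trans (ler_normD _ _) _; rewrite !normrZ.
apply: (@le_lt_trans _ _ (`|h| * (`|w| + `|v| + 1))); last by rewrite -ltr_pdivlMr.
by rewrite mulrDr mulr1 mulrDr ler_wpDr// lerD2r ler_wpM2r.
Unshelve. all: by end_near. Qed.

End directional.

(** * C^1 functions along rays *)

Section ray.
Context {R : realType} (n : nat).
Notation mu := (@lebesgue_measure R).
Implicit Types (f : 'rV[R]_n -> R) (x z w : 'rV[R]_n).

(** Only partial derivatives are required; derivatives in every direction follow in
    [is_derive_grad]. *)
Definition C1 f := [/\ continuous f, (forall i x, derivable f x (delta_mx 0 i)) &
  forall i, continuous (partial i f)].

(** A cube in place of a compact set: the condition passes to slices, as the induction on the
    dimension in [integral_partial0] demands. *)
Definition supp_in (M : R) f := forall (x : 'rV[R]_n) i, M < `|x 0 i| -> f x = 0.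

Lemma smooth_C1 f : smooth f -> C1 f.
Proof.
move=> sf; have [/= c0 d0] := sf [::]; split => // i.
by have [/= ci _] := sf [:: i].
Qed.

(** The vector [v] is expanded in the canonical basis and its components are added one by one by
    [is_deriveD_dir]. *)
Lemma is_derive_grad f x (v : 'rV[R]_n) : C1 f -> is_derive x v f (\sum_i v 0 i * partial i f x).
Proof.
move=> [cf df cd].
rewrite [X in is_derive _ X](row_sum_delta v).
elim: (index_enum 'I_n) => [|j s IH]; first by rewrite !big_nil; exact: is_derive0.
rewrite !big_cons [X in is_derive _ X]addrC [X in is_derive _ _ _ X]addrC.
have dj z : is_derive z (v 0 j *: delta_mx 0 j) f (v 0 j * partial j f z).
  by apply: is_deriveZ_dir; exact: df.
have dEx z : 'D_(v 0 j *: delta_mx 0 j) f z = v 0 j * partial j f z.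
  exact: derive_val.
have dE : 'D_(v 0 j *: delta_mx 0 j) f = (fun z => v 0 j * partial j f z).
  by apply/funext => z; exact: dEx.
have := is_deriveD_dir (w := v 0 j *: delta_mx 0 j) IH.
rewrite dE dEx => H; apply: H; first by move=> z; case: (dj z).
apply: (@continuousM _ _ (fun=> v 0 j) (partial j f)); last exact: cd.
exact: cst_continuous.
Qed.

Lemma continuous_grad_line f z w : C1 f ->
  continuous (fun r : R => \sum_i w 0 i * partial i f (r *: w + z)).
Proof.
move=> [_ _ cd]; apply: continuous_big => [|i _ r]; first exact: add_continuous.
apply: cvgM; first exact: cvg_cst.
apply: (@cvg_comp _ _ _ (fun r : R => r *: w + z) (partial i f) _ (nbhs (r *: w + z)));
  last exact: cd.
by apply: cvgD; [exact: scalel_continuous|exact: cvg_cst].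
Qed.

(** The fundamental theorem of calculus from [z] to a point of the ray outside the support,
    Cauchy-Schwarz bounding the derivative along the ray. *)
Lemma C1_ray_bound f M z w : C1 f -> supp_in M f -> w != 0 ->
  (`|f z|%:E <= \int[mu]_(r in `[0%R, +oo[)
     (eucl_norm (grad f (z + r *: w)) * eucl_norm w)%:E)%E.
Proof.
move=> C1f suppf w0; have [cf df cd] := C1f.
have [i wi] : exists i, w 0 i != 0.
  apply: contrapT => h; move/eqP: w0; apply; apply/rowP => i; rewrite mxE.
  by apply: contrapT => wi; apply: h; exists i; exact/eqP.
pose g (r : R) := f (r *: w + z).
pose g' (r : R) := \sum_i w 0 i * partial i f (r *: w + z).
have dg r : is_derive r (1 : R) g (g' r).
  have := is_derive_grad (r *: w + z) w C1f => h.
  have {}h1 : derivable f (r *: w + z) w by case: h.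
  by have := is_derive_line h1; rewrite (@derive_val _ _ _ _ _ _ _ h).
have cg' : continuous g' by exact: continuous_grad_line.
(* Long enough to leave the support: |T w_i| - |z_i| = 1 + |M|. *)
pose T := (1 + `|M| + `|z 0 i|) / `|w 0 i|.
have T0 : 0 < T by rewrite divr_gt0 ?normr_gt0// ltr_pwDl// addr_ge0.
have gT : g T = 0.
  apply: (suppf _ i); rewrite !mxE.
  apply: (@lt_le_trans _ _ (`|T * w 0 i| - `|- z 0 i|)); last first.
    by rewrite -{2}[z 0 i]opprK; exact: lerB_dist.
  rewrite normrN normrM (gtr0_norm T0) /T divfK ?normr_eq0// addrK.
  by rewrite (le_lt_trans (ler_norm M))// ltrDr.
have cg r : {for r, continuous g}.
  by apply: differentiable_continuous; apply/derivable1_diffP; case: (dg r).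
have ftc : (\int[mu]_(r in `[0%R, T]) (g' r)%:E = (- f z)%:E)%E.
  rewrite (@continuous_FTC2 R g' g)//.
  - by rewrite gT -EFinD add0r /g scale0r add0r.
  - exact: continuous_subspaceT.
  - split.
    + by move=> r _; case: (dg r).
    + by apply: cvg_at_right_filter; exact: cg.
    + by apply: cvg_at_left_filter; exact: cg.
  - by move=> r _; rewrite derive1E; exact: derive_val.
have mg' : measurable_fun setT (EFin \o g').
  by apply/measurable_EFinP; exact: continuous_measurable_fun.
rewrite -normrN -abse_EFin -ftc.
apply: le_trans; first by apply: le_abse_integral => //; exact: measurable_funTS.
apply: (@le_trans _ _ (\int[mu]_(r in `[0%R, T])
     (eucl_norm (grad f (z + r *: w)) * eucl_norm w)%:E)%E).
  apply: ge0_integral_le => [r _|r _]; first exact: abse_ge0.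
  rewrite abse_EFin lee_fin mulrC /g' addrC (le_trans (sum_mul_le_sqrt _ _))//.
  by rewrite ler_wpM2l ?sqrtr_ge0// le_eqVlt; apply/orP; left; apply/eqP; congr Num.sqrt;
    apply: eq_bigr => j _; rewrite mxE.
rewrite integral_mkcond [leRHS]integral_mkcond.
apply: ge0_integral_le => r _.
  by apply: erestrict_ge0 => ? _; rewrite lee_fin mulr_ge0// eucl_norm_ge0.
apply: restrict_lee => [t _|t]; first by rewrite lee_fin mulr_ge0// eucl_norm_ge0.
by rewrite /= !in_itv/= => /andP[->].
Qed.

End ray.

(** * Compact sets, slices and integration by parts *)

Section integration_by_parts.
Context {R : realType}.
Notation mu := (@lebesgue_measure R).

Lemma compact_box n (M : R) :
  compact [set x : 'rV[R]_n | forall i, `[- M, M]%classic (x 0 i)].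
Proof. by apply: (@rV_compact R n (fun=> `[- M, M]%classic)) => i; exact: segment_compact. Qed.

Lemma compact_rV_sub_box n (K : set 'rV[R]_n) : compact K ->
  exists M, forall x, K x -> forall i, `|x 0 i| <= M.
Proof.
move=> /compact_bounded[M [Mr hM]]; exists (M + 1) => x Kx i.
apply: le_trans (hM _ _ _ Kx); last by rewrite ltrDl.
rewrite [leRHS]/Num.Def.normr/= mx_normrE.
by apply: (le_trans _ (le_bigmax _ _ (0, i))).
Qed.

Lemma compact_rV_measurable n (K : set 'rV[R]_n) : compact K -> measurable K.
Proof.
move=> cK; rewrite -(setCK K); apply: measurableC; apply: open_measurable_rV.
by apply: closed_openC; apply: compact_closed => //; exact: norm_hausdorff.
Qed.

Lemma compact_rV_finite n (K : set 'rV[R]_n) : compact K -> (lebesgue_rV n K < +oo)%E.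
Proof.
move=> cK; have [M hM] := compact_rV_sub_box cK.
pose J : set R := `[- M, M]%classic.
have mJ : measurable J by exact: measurable_itv.
apply: (@le_lt_trans _ _ (lebesgue_rV n [set x : 'rV[R]_n | forall i, J (x 0 i)])).
  apply: le_measure; rewrite ?inE.
  - by apply: compact_rV_measurable.
  - exact: (@measurable_box R n (fun=> J)).
  - by move=> x /hM xM i; rewrite /J/= in_itv/= -ler_norml.
rewrite lebesgue_rV_box// lebesgue_measure_itv/=; case: ifPn => _.
  by rewrite -EFinD -EFin_expe ltry.
by rewrite -EFin_expe ltry.
Qed.

Lemma continuous_compact_integrable_rV n (f : 'rV[R]_n -> R) (K : set 'rV[R]_n) :
  continuous f -> compact K -> (lebesgue_rV n).-integrable K (EFin \o f).
Proof.
move=> cf cK; apply: measurable_bounded_integrable.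
- by apply: compact_rV_measurable.
- exact: compact_rV_finite.
- by apply: measurable_funTS; exact: continuous_measurable_rV.
- have := compact_bounded (continuous_compact (continuous_subspaceT cf) cK).
  by case=> M [Mr hM]; exists M; split => // N MN y Ky; apply: (hM N MN); exists y.
Qed.

Lemma supp_in_integrable n (f : 'rV[R]_n -> R) (M : R) :
  continuous f -> supp_in M f -> (lebesgue_rV n).-integrable setT (EFin \o f).
Proof.
move=> cf sf; pose K := [set x : 'rV[R]_n | forall i, `[- M, M]%classic (x 0 i)].
have cK : compact K by exact: compact_box.
have -> : EFin \o f = (EFin \o f) \_ K.
  apply/funext => x; rewrite patchE; case: ifPn => // /negP; rewrite inE => nK /=.
  apply: contrapT => fx; apply: nK => i; rewrite /= in_itv/= -ler_norml leNgt.
  by apply/negP => /sf fx0; apply: fx; rewrite fx0.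
have mK : measurable K by apply: compact_rV_measurable.
apply/(integrable_mkcond (EFin \o f) mK).
exact: continuous_compact_integrable_rV.
Qed.

(** The condition M < |x_j| is open, so [f] vanishes in a neighbourhood of such an [x]. *)
Lemma supp_in_partial n (f : 'rV[R]_n -> R) (M : R) i : supp_in M f ->
  supp_in M (partial i f).
Proof.
move=> sf x j xj; rewrite /partial (@near_eq_derive _ _ _ _ (cst 0)) ?derive_cst//.
have : \forall y \near x, M < `|(y : 'rV[R]_n) 0 j|.
  exact: cvgr_gt _ (cvg_norm (@coord_continuous R 1 n 0 j x)) _ xj.
by apply: filterS => y; exact: sf.
Qed.

Lemma continuous_rV (T : topologicalType) n (g : T -> 'rV[R]_n) :
  (forall i, continuous (fun t => g t 0 i)) -> continuous g.
Proof.
move=> cg t; apply/cvg_ballP => e e0.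
have : \forall s \near t, forall i, ball (g t 0 i) e (g s 0 i).
  by apply: filter_forall => i; have /cvg_ballP := cg i t; exact.
by apply: filterS => s h; split => // i j; rewrite (ord1 i); exact: h.
Qed.

Lemma continuous_cons_rVr n (a : R) : continuous (fun y : 'rV[R]_n => cons_rV (a, y)).
Proof.
apply: continuous_rV => i; have [j ->|->] := unliftP ord0 i.
  by under eq_fun do rewrite cons_rVS; exact: coord_continuous.
by under eq_fun do rewrite cons_rV0; exact: cst_continuous.
Qed.

Lemma continuous_cons_rVl n (y : 'rV[R]_n) : continuous (fun a : R => cons_rV (a, y)).
Proof.
apply: continuous_rV => i; have [j ->|->] := unliftP ord0 i.
  by under eq_fun do rewrite cons_rVS; exact: cst_continuous.
by under eq_fun do rewrite cons_rV0.
Qed.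

Lemma cons_rV_line0 n (h a : R) (y : 'rV[R]_n) :
  h *: delta_mx 0 ord0 + cons_rV (a, y) = cons_rV (h + a, y).
Proof.
apply/rowP => i; rewrite [LHS]mxE [X in X + _]mxE [X in _ * X]mxE.
have [j ->|->] := unliftP ord0 i; rewrite ?cons_rVS ?cons_rV0/=.
  by rewrite ?(eq_sym _ ord0) ?(negbTE (neq_lift _ _)) mulr0 add0r.
by rewrite ?eqxx ?mulr1.
Qed.

Lemma cons_rV_lineS n (h a : R) (y : 'rV[R]_n) j :
  h *: delta_mx 0 (lift ord0 j) + cons_rV (a, y) = cons_rV (a, h *: delta_mx 0 j + y).
Proof.
apply/rowP => i; rewrite [LHS]mxE [X in X + _]mxE [X in _ * X]mxE.
have [k ->|->] := unliftP ord0 i; rewrite ?cons_rVS ?cons_rV0/=.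
  by rewrite !mxE (inj_eq lift_inj).
by rewrite ?(negbTE (neq_lift _ _)) ?mulr0 ?add0r.
Qed.

Lemma integral_derive0 (g g' : R -> R) (M : R) : (forall t, is_derive t (1 : R) g (g' t)) ->
  continuous g' -> (forall t, M < `|t| -> g t = 0) -> (forall t, M < `|t| -> g' t = 0) ->
  (\int[mu]_t (g' t)%:E = 0)%E.
Proof.
move=> dg cg' g0 g'0.
pose N := `|M| + 1; have N0 : 0 < N by rewrite ltr_wpDl.
have MN t : N <= `|t| -> M < `|t|.
  by move=> Nt; rewrite (le_lt_trans (ler_norm M))// (lt_le_trans _ Nt)// ltrDl.
have cg r : {for r, continuous g}.
  by apply: differentiable_continuous; apply/derivable1_diffP; case: (dg r).
rewrite (_ : (fun t => (g' t)%:E) = (fun t => (g' t)%:E) \_ `[- N, N]).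
  rewrite -integral_mkcond (@continuous_FTC2 R g' g)//.
  - by rewrite !g0 ?subee//; apply: MN; rewrite ?normrN ger0_norm// ltW.
  - by rewrite gtrN.
  - exact: continuous_subspaceT.
  - split.
    + by move=> r _; case: (dg r).
    + by apply: cvg_at_right_filter; exact: cg.
    + by apply: cvg_at_left_filter; exact: cg.
  - by move=> r _; rewrite derive1E; exact: derive_val.
apply/funext => t; rewrite patchE; case: ifPn => // /negP; rewrite inE/= in_itv/= -ler_norml.
by move=> /negP; rewrite -ltNge => /ltW /MN /g'0 ->.
Qed.

(** By Fubini. If [i] is the first coordinate, the integral over that coordinate vanishes by the
    fundamental theorem of calculus; otherwise each slice at a fixed first coordinate satisfies the
    hypotheses one dimension lower. *)
Lemma integral_partial0 n (f : 'rV[R]_n -> R) (M : R) i : continuous f ->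
  (forall x, derivable f x (delta_mx 0 i)) -> continuous (partial i f) ->
  supp_in M f -> (\int[lebesgue_rV n]_x (partial i f x)%:E = 0)%E.
Proof.
elim: n f i => [f []//|n IH f i cf df cd sf].
have spf := supp_in_partial i sf.
have pint := supp_in_integrable cd spf.
have pint' := integrable_cons_rV pint.
rewrite integral_cons_rV//.
have [j ij|i0] := unliftP ord0 i.
  rewrite -integral12_prod_meas1// /fubini_F integral0_eq// => a _.
  pose fa (y : 'rV[R]_n) := f (cons_rV (a, y)).
  have qE (y : 'rV[R]_n) :
      (fun h : R => h^-1 *: ((f \o shift (cons_rV (a, y))) (h *: delta_mx 0 i)
        - f (cons_rV (a, y)))) =
      (fun h => h^-1 *: ((fa \o shift y) (h *: delta_mx 0 j) - fa y)).
    by apply/funext => h; rewrite /fa/= ij cons_rV_lineS.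
  have dE (y : 'rV[R]_n) : partial i f (cons_rV (a, y)) = partial j fa y.
    by rewrite /partial /derive qE.
  under eq_integral do rewrite /= dE.
  apply: IH.
  - by move=> y; apply: continuous_comp; [exact: continuous_cons_rVr|exact: cf].
  - move=> y; have := df (cons_rV (a, y)); by rewrite /derivable qE.
  - have -> : partial j fa = (fun y : 'rV[R]_n => partial i f (cons_rV (a, y))).
      by apply/funext => y; rewrite dE.
    by move=> y; apply: continuous_comp; [exact: continuous_cons_rVr|exact: cd].
  - by move=> y k yk; apply: (sf _ (lift ord0 k)); rewrite cons_rVS.
rewrite -integral21_prod_meas1// /fubini_G integral0_eq// => y _.
rewrite /=; apply: (@integral_derive0 (fun a => f (cons_rV (a, y))) _ M).
- move=> t; have := is_derive_line (f := f) (y := cons_rV (0, y)) (w := delta_mx 0 i) (t := t).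
  have E s : s *: delta_mx 0 i + cons_rV (0, y) = cons_rV (s, y).
    by rewrite i0 cons_rV_line0 addr0.
  rewrite E => /(_ (df _)).
  by rewrite (_ : (fun s : R => f (s *: delta_mx 0 i + cons_rV (0, y))) = fun a => f (cons_rV (a, y)));
    last by apply/funext => s; rewrite E.
- by move=> t; apply: continuous_comp; [exact: continuous_cons_rVl|exact: cd].
- by move=> t Mt; apply: (sf _ ord0); rewrite cons_rV0.
- by move=> t Mt; apply: (spf _ ord0); rewrite cons_rV0.
Qed.

(** The product [u * phi] inherits the bounded support of [phi], so the integral of its partial
    derivative is 0; the Leibniz rule splits it into two integrable terms. *)
Lemma integral_by_parts_rV n (u phi : 'rV[R]_n -> R) (M : R) i : C1 u -> C1 phi ->
  supp_in M phi ->
  (\int[lebesgue_rV n]_x (u x * partial i phi x)%:E =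
  - \int[lebesgue_rV n]_x (partial i u x * phi x)%:E)%E.
Proof.
move=> [cu du cdu] [cp dp cdp] sp.
have E x : partial i (u * phi) x = u x * partial i phi x + partial i u x * phi x.
  by rewrite /partial deriveM// /GRing.scale/= [phi x * _]mulrC.
have cM (f g : 'rV[R]_n -> R) : continuous f -> continuous g -> continuous (fun x => f x * g x).
  by move=> cf cg x; apply: (@continuousM _ _ f g); [exact: cf|exact: cg].
have i1 : (lebesgue_rV n).-integrable setT (fun x => (u x * partial i phi x)%:E).
  apply: (@supp_in_integrable _ _ M); first exact: cM.
  by move=> x j /(supp_in_partial i sp) ->; rewrite mulr0.
have i2 : (lebesgue_rV n).-integrable setT (fun x => (partial i u x * phi x)%:E).
  apply: (@supp_in_integrable _ _ M); first exact: cM.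
  by move=> x j /sp ->; rewrite mulr0.
have : (\int[lebesgue_rV n]_x (partial i (u * phi)%R x)%:E = 0)%E.
  apply: (@integral_partial0 _ _ M).
  - exact: cM.
  - by move=> x; exact: derivableM.
  - rewrite (_ : partial i (u * phi) = (fun x => u x * partial i phi x + partial i u x * phi x)).
      move=> x; apply: (@continuousD _ _ _ (fun x => u x * partial i phi x)
        (fun x => partial i u x * phi x)); exact: cM.
    exact/funext.
  - by move=> x j /sp phi0; rewrite -[LHS]/(u x * phi x) phi0 mulr0.
under eq_integral do rewrite E EFinD.
rewrite integralD//.
have := integrable_fin_num measurableT i1; have := integrable_fin_num measurableT i2.
move=> /fineK <- /fineK <- /eqP.
by rewrite -EFinD eqe addr_eq0 => /eqP ->; rewrite EFinN.
Qed.

End integration_by_parts.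

(** * The kernel |y|^(1-n) and Lorentz norms *)

Section hardy_littlewood.
Context {R : realType}.
Notation mu := (@lebesgue_measure R).
Local Open Scope ereal_scope.

Lemma measurable_set_ltr d (T : measurableType d) (f g : T -> R) :
  measurable_fun setT f -> measurable_fun setT g -> measurable [set x | (f x < g x)%R].
Proof.
move=> mf mg; rewrite -[X in measurable X]setTI.
exact: (measurable_fun_ltr mf mg measurableT (Y := [set true])).
Qed.

Lemma measurable_set_lte d (T : measurableType d) (f : T -> R) (g : T -> \bar R) :
  measurable_fun setT f -> measurable_fun setT g ->
  measurable [set x | (f x)%:E < g x].
Proof.
move=> mf mg; rewrite -[X in measurable X]setTI.
by apply: measurable_lte => //; exact/measurable_EFinP.
Qed.

Lemma integral_weight_indic d (T : measurableType d) (m : {measure set T -> \bar R})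
    (c : R) (D : set T) : (0 <= c)%R -> measurable D ->
  \int[m]_x (c * \1_D x)%:E = c%:E * m D.
Proof.
move=> c0 mD; under eq_integral do rewrite EFinM.
rewrite ge0_integralZl//; first by rewrite integral_indic// setIT.
- by apply/measurable_EFinP; exact: measurable_indic.
Qed.

Lemma powR_div (a t : R) : (0 < t)%R -> (t `^ a / t = t `^ (a - 1))%R.
Proof.
by move=> t0; rewrite powRB ?powRr1 ?(ltW t0)//; apply/implyP => _; rewrite gt_eqF.
Qed.

Context (n : nat) (n1 : (1 < n)%N).

(** At the origin the value is 0, by the convention for powers of 0, and not infinite; the cases |y|
    = 0 below are therefore trivial. *)
Definition kernel_rV (y : 'rV[R]_n) : R := eucl_norm y `^ (1 - n%:R).

Lemma kernel_rV_ge0 y : (0 <= kernel_rV y)%R.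
Proof. exact: powR_ge0. Qed.

Lemma measurable_kernel_rV : measurable_fun setT kernel_rV.
Proof. exact: (measurableT_comp (measurable_powR _) (@measurable_eucl_norm R n)). Qed.

Let n10 : (1 - n%:R < 0 :> R)%R.
Proof. by rewrite subr_lt0 ltr1n. Qed.

(** With c = |y| this writes the kernel as a superposition of indicators of centred balls |y| < r,
    which reduces the bathtub principle to volumes of intersections with balls. With n + 1 in place
    of n it also produces the factor 1/n in [C1_representation]. *)
Lemma integral_tail_power (c : R) : (0 < c)%R ->
  \int[mu]_r (((n%:R - 1) * r `^ (- n%:R)) * \1_[set r | (c < r)%R] r)%:E =
  (c `^ (1 - n%:R))%:E.
Proof.
move=> c0; transitivity (\int[mu]_(r in `]c, +oo[) ((n%:R - 1) * r `^ (- n%:R))%:E).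
  rewrite [RHS]integral_mkcond; apply: eq_integral => r _.
  rewrite patchE indicE; have -> : (r \in `]c, +oo[%classic) = (r \in [set r | (c < r)%R]).
    by apply/idP/idP; rewrite !inE/= in_itv/= andbT.
  by case: ifPn => _; rewrite ?mulr1 ?mulr0.
under eq_integral do rewrite EFinM.
have mP : measurable_fun (`]c, +oo[%classic : set R) (fun r => (r `^ (- n%:R))%:E).
  exact: measurable_powR_itv.
rewrite ge0_integralZl//; last 2 first.
- by move=> r _; rewrite lee_fin powR_ge0.
- by rewrite lee_fin -oppr_le0 opprB ltW.
have E : (- n%:R)%R = (1 - n%:R - 1 :> R)%R by ring.
rewrite integral_itv_obnd_cbnd// [in LHS]E integral_powR_y// -EFinM; congr EFin.
by rewrite opprB mulrC divfK// subr_eq0 gt_eqF// ltr1n.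
Qed.

Local Notation Om := (unit_ball_volume R n).

(** The decreasing rearrangement of the kernel: the value of |y|^(1-n) on the boundary of the
    centred ball of volume t, whose radius is (t/Om)^(1/n). *)
Definition bathtub_weight (t : R) : R := Om `^ (1 - n%:R^-1) * t `^ (n%:R^-1 - 1).

Lemma bathtub_weight_ge0 t : (0 <= bathtub_weight t)%R.
Proof. by rewrite mulr_ge0// powR_ge0. Qed.

Definition up_to (a : \bar R) : set R := [set t : R | (0 < t)%R /\ t%:E < a].

(** After the kernel is decomposed into balls, the claim rests on |A ∩ B(0, r)| <= min(|A|, r^n Om).
    This minimum is itself the length of an interval of t's, and exchanging the integrals in r and t
    reassembles the rearranged kernel. *)
Lemma kernel_bathtub (A : set 'rV[R]_n) : measurable A ->
  \int[lebesgue_rV n]_y (\1_A y * kernel_rV y)%:E <=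
  \int[mu]_t (bathtub_weight t * \1_(up_to (lebesgue_rV n A)) t)%:E.
Proof.
move=> mA.
pose w (r : R) : R := ((n%:R - 1) * r `^ (- n%:R))%R.
have w0 r : (0 <= w r)%R.
  by rewrite mulr_ge0 ?powR_ge0// -oppr_le0 opprB ltW.
have mw : measurable_fun setT w by apply: measurable_funM => //; exact: measurable_powR.
pose D : set ('rV[R]_n * R) := [set p | A p.1 /\ (eucl_norm p.1 < p.2)%R].
have mD : measurable D.
  rewrite (_ : D = (A `*` setT) `&` [set p | (eucl_norm p.1 < p.2)%R]); last first.
    by apply/seteqP; split => p [] => [? ?|[? _] ?].
  apply: measurableI; first exact: measurableX.
  apply: measurable_set_ltr => //.
  exact: (measurableT_comp (@measurable_eucl_norm R n)).
pose h (p : 'rV[R]_n * R) : \bar R := (w p.2 * \1_D p)%:E.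
have h0 p : 0 <= h p by rewrite lee_fin mulr_ge0.
have mh : measurable_fun setT h.
  apply/measurable_EFinP; apply: measurable_funM; last exact: measurable_indic.
  exact: (measurableT_comp mw).
(* At fixed r > 0 the section is the interval ]0, min(|A|, r^n Om)[; at fixed t in ]0, |A|[ it is
   the half-line beyond the radius of the ball of volume t. *)
pose E : set (R * R) := [set p | [/\ (0 < p.1)%R, (0 < p.2)%R, p.2%:E < lebesgue_rV n A &
   (p.2 < p.1 ^+ n * Om)%R]].
have mE : measurable E.
  rewrite (_ : E = [set p | (0 < p.1)%R] `&` ([set p | (0 < p.2)%R] `&`
      ([set p | p.2%:E < lebesgue_rV n A] `&` [set p | (p.2 < p.1 ^+ n * Om)%R]))); last first.
    by apply/seteqP; split => p; [move=> []|move=> [? [? []]]].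
  apply: measurableI; first exact: measurable_set_ltr.
  apply: measurableI; first exact: measurable_set_ltr.
  apply: measurableI; first exact: measurable_set_lte.
  apply: measurable_set_ltr => //; apply: measurable_funM => //.
  exact: measurable_funX.
pose g (p : R * R) : \bar R := (w p.1 * \1_E p)%:E.
have g0 p : 0 <= g p by rewrite lee_fin mulr_ge0.
have mg : measurable_fun setT g.
  apply/measurable_EFinP; apply: measurable_funM; last exact: measurable_indic.
  exact: (measurableT_comp mw).
apply: (@le_trans _ _ (\int[lebesgue_rV n]_y \int[mu]_r h (y, r))).
  apply: ge0_integral_le => y _; first by rewrite lee_fin mulr_ge0// kernel_rV_ge0.
  rewrite /h/= indicE; case: (boolP (y \in A)) => [|_]; last first.
    by rewrite mul0r; apply: integral_ge0 => r _; rewrite lee_fin mulr_ge0.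
  rewrite inE mul1r => Ay; have [y0|y0] := eqVneq (eucl_norm y) 0%R.
    rewrite /kernel_rV y0 powR0 ?lt_eqF//.
    by apply: integral_ge0 => r _; rewrite lee_fin mulr_ge0.
  rewrite /kernel_rV -integral_tail_power ?lt_def ?y0 ?eucl_norm_ge0//.
  apply: ge0_integral_le => r _; first by rewrite lee_fin mulr_ge0 ?w0.
  rewrite lee_fin ler_wpM2l ?w0// !indicE ler_nat; case: (boolP (r \in _)) => //.
  by rewrite inE => yr; rewrite mem_set.
rewrite (fubini_tonelli (m1 := lebesgue_rV n) (m2 := mu) h mh h0).
apply: (@le_trans _ _ (\int[mu]_r \int[mu]_t g (r, t))).
  apply: ge0_integral_le => r _; first exact: integral_ge0.
  have [r0|r0] := leP r 0%R.
    rewrite integral0_eq; first exact: integral_ge0.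
    move=> y _; rewrite /h/= indicE memNset ?mulr0// => -[_] /=.
    by rewrite ltNge (le_trans r0)// eucl_norm_ge0.
  have mAB : measurable (A `&` eucl_ball r).
    by apply: measurableI => //; apply: measurable_eucl_ball.
  have -> : \int[lebesgue_rV n]_y h (y, r) =
      (w r)%:E * lebesgue_rV n (A `&` eucl_ball r).
    by rewrite -integral_weight_indic.
  have b0 : (0 <= r ^+ n * Om)%R.
    by rewrite mulr_ge0 ?exprn_ge0 ?(ltW r0)// ltW// unit_ball_volume_gt0.
  (* Finite even if |A| is infinite, thanks to the volume of the ball. *)
  pose M := mine (lebesgue_rV n A) (r ^+ n * Om)%:E.
  have MR : M \is a fin_num.
    by rewrite ge0_fin_numE ?gt_min ?ltry ?orbT// le_min measure_ge0 lee_fin.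
  have M0 : (0 <= fine M)%R by rewrite fine_ge0// le_min measure_ge0 lee_fin.
  have gE : (fun t => g (r, t)) = (fun t => (w r * \1_(`]0%R, (fine M)[%classic : set R) t)%:E).
    apply/funext => t; rewrite /g/= !indicE; congr (_ * (nat_of_bool _)%:R)%:E.
    apply/idP/idP; rewrite !inE/= in_itv/= -[(t < fine M)%R]lte_fin (fineK MR) lt_min lte_fin.
      by move=> [_ -> -> ->].
    by move=> /andP[? /andP[? ?]]; split.
  rewrite gE (integral_weight_indic mu (w0 r) (measurable_itv _)).
  apply: lee_wpmul2l; first by rewrite lee_fin.
  apply: (@le_trans _ _ M).
    rewrite le_min; apply/andP; split.
      by apply: le_measure; [rewrite inE|rewrite inE|exact: subIsetl].
    have mB := measurable_eucl_ball (R := R) (n := n) r.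
    by rewrite -eucl_ball_volume//; apply: le_measure; [rewrite inE|rewrite inE|exact: subIsetr].
  change (M <= mu `]0%R, (fine M)[%classic).
  rewrite lebesgue_measure_itv/= lte_fin -{1}(fineK MR).
  by case: ltP => // M0'; rewrite ?sube0// lee_fin.
rewrite (fubini_tonelli (m1 := mu) (m2 := mu) g mg g0).
apply: ge0_integral_le => t _; first exact: integral_ge0.
have [[t0 ta]|tA] := pselect ((0 < t)%R /\ t%:E < lebesgue_rV n A); last first.
  rewrite [leLHS]integral0_eq => [|r _].
    by rewrite lee_fin mulr_ge0 ?bathtub_weight_ge0.
  by rewrite /g/= indicE memNset ?mulr0// => -[/= _ ? ? _]; apply: tA.
rewrite [X in _ <= X](_ : _ = (bathtub_weight t)%:E); last first.
  by rewrite indicE mem_set// mulr1.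
have O0 := unit_ball_volume_gt0 (R := R) n.
have n0 : (n%:R != 0 :> R)%R by rewrite pnatr_eq0 -lt0n ltnW.
(* The radius of the ball of volume [t]. *)
pose c := ((t / Om) `^ n%:R^-1)%R.
have c0 : (0 < c)%R by rewrite powR_gt0// divr_gt0.
have <- : (c `^ (1 - n%:R))%:E = (bathtub_weight t)%:E.
  congr EFin; rewrite /c -powRrM mulrBr mulr1 mulVf// powRM ?(ltW t0) ?invr_ge0 ?(ltW O0)//.
  by rewrite mulrC /bathtub_weight -powR_inv1 ?(ltW O0)// -powRrM mulN1r opprB.
rewrite -integral_tail_power//; apply: ge0_integral_le => r _; first exact: g0.
rewrite /g lee_fin ler_wpM2l ?w0// !indicE ler_nat; case: (boolP ((r, t) \in E)) => //.
rewrite inE => -[/= r0 _ _ tr]; rewrite mem_set//= ltNge; apply/negP => rc.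
move: tr; rewrite ltNge => /negP; apply.
rewrite -ler_pdivlMr// -(powR_mulrn _ (ltW r0)).
have cn : (c `^ n%:R = t / Om)%R.
  by rewrite /c -powRrM mulVf// powRr1// divr_ge0// ltW.
by rewrite -cn; apply: ge0_ler_powR; rewrite ?nnegrE// ltW.
Qed.

Lemma distribution_fun_nonincreasing (F : 'rV[R]_n -> R) (v s : R) :
  measurable_fun setT F -> (v <= s)%R -> distribution_fun F s <= distribution_fun F v.
Proof.
move=> mF vs.
have mFs u : measurable [set x | (u < `|F x|)%R].
  by apply: measurable_set_ltr => //; exact: measurableT_comp.
by apply: le_measure; [rewrite inE|rewrite inE|move=> x /=; exact: le_lt_trans].
Qed.

Lemma rearrangement_ge0 (F : 'rV[R]_n -> R) t : 0 <= rearrangement F t.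
Proof. by apply: le_ereal_inf_tmp => _ [v [v0 _] <-]; rewrite lee_fin. Qed.

(** The distribution function is nonincreasing, so every [s] in [S] is at most the rearrangement at
    [t], and [S] lies in an interval of that length. This is the half of the layer-cake identity
    that an upper bound by the Lorentz norm calls for. *)
Lemma rearrangement_ge (F : 'rV[R]_n -> R) (t : R) (S : set R) :
  measurable_fun setT F -> measurable S ->
  (forall s, S s -> (0 < s)%R /\ t%:E < distribution_fun F s) ->
  mu S <= rearrangement F t.
Proof.
move=> mF mS hS.
have sle s : S s -> s%:E <= rearrangement F t.
  move=> /hS[s0 ts]; apply: le_ereal_inf_tmp => _ [v [v0 vt] <-]; rewrite lee_fin leNgt.
  apply/negP => vs; move: ts; rewrite ltNge => /negP; apply.
  by apply: le_trans vt; apply: distribution_fun_nonincreasing => //; exact: ltW.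
have := rearrangement_ge0 F t; move: sle; case: rearrangement => [y| |] //= sle y0; last first.
  by rewrite leey.
apply: (@le_trans _ _ (mu `[0%R, y]%classic)).
  apply: le_measure; rewrite ?inE//.
  move=> s Ss /=; have [s0 _] := hS s Ss.
  by rewrite in_itv/= (ltW s0)/= -lee_fin; exact: sle.
rewrite lebesgue_measure_itv/= lte_fin; case: ltP => // _.
by rewrite sube0.
Qed.

(** Layer-cake decomposition of [F]: the bathtub bound applies to each superlevel set, translated by
    [z]. Once the integrals are exchanged, t^(1/n-1) is multiplied by the length of the set of
    levels s with |F > s| > t, which is at most the rearrangement at t. *)
Lemma kernel_hardy_littlewood (F : 'rV[R]_n -> R) (z : 'rV[R]_n) :
  measurable_fun setT F -> (forall x, (0 <= F x)%R) ->
  \int[lebesgue_rV n]_y (F (z + y)%R * kernel_rV y)%:E <=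
  (Om `^ (1 - n%:R^-1))%:E * lorentz_norm F.
Proof.
move=> mF F0.
have mFz : measurable_fun setT (fun y => F (z + y)%R).
  have := measurableT_comp mF (measurable_affine_rV z 1%R).
  by under eq_fun do rewrite /= scale1r.
pose D : set ('rV[R]_n * R) := [set p | (0 < p.2)%R /\ (p.2 < F (z + p.1))%R].
have mD : measurable D.
  rewrite (_ : D = [set p | (0 < p.2)%R] `&` [set p | (p.2 < F (z + p.1))%R])//.
  apply: measurableI; first exact: measurable_set_ltr.
  by apply: measurable_set_ltr => //; exact: (measurableT_comp mFz).
pose h (p : 'rV[R]_n * R) : \bar R := (kernel_rV p.1 * \1_D p)%:E.
have h0 p : 0 <= h p by rewrite lee_fin mulr_ge0// kernel_rV_ge0.
have mh : measurable_fun setT h.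
  apply/measurable_EFinP; apply: measurable_funM; last exact: measurable_indic.
  exact: (measurableT_comp measurable_kernel_rV).
have -> : \int[lebesgue_rV n]_y (F (z + y)%R * kernel_rV y)%:E =
    \int[lebesgue_rV n]_y \int[mu]_s h (y, s).
  apply: eq_integral => y _.
  have -> : (fun s => h (y, s)) = (fun s => (kernel_rV y * \1_(`]0%R, (F (z + y)%R)[%classic : set R) s)%:E).
    apply/funext => s; rewrite /h/= !indicE; congr (_ * (nat_of_bool _)%:R)%:E.
    by apply/idP/idP; rewrite !inE/= in_itv/= => /andP.
  rewrite (integral_weight_indic mu (kernel_rV_ge0 y) (measurable_itv _)).
  rewrite EFinM muleC; congr (_ * _).
  change ((F (z + y)%R)%:E = mu `]0%R, (F (z + y)%R)[%classic).
  rewrite lebesgue_measure_itv/= lte_fin sube0; case: ltP => // Fz.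
  by congr EFin; apply/eqP; rewrite eq_le Fz F0.
rewrite (fubini_tonelli (m1 := lebesgue_rV n) (m2 := mu) h mh h0).
have mlam : measurable_fun setT (distribution_fun F).
  pose L : set ('rV[R]_n * R) := [set p | (p.2 < `|F p.1|)%R].
  have mL : measurable L.
    apply: measurable_set_ltr => //; apply: measurableT_comp => //.
    exact: (measurableT_comp mF).
  have := measurable_fun_fubini_tonelli_G (m1 := lebesgue_rV n) (fun p => (\1_L p)%:E).
  rewrite /fubini_G => H.
  rewrite (_ : distribution_fun F = fun s => \int[lebesgue_rV n]_y (\1_L (y, s))%:E).
    by apply: H => //; apply/measurable_EFinP; exact: measurable_indic.
  apply/funext => s; rewrite /distribution_fun.
  have mB : measurable [set x | (s < `|F x|)%R].
    by apply: measurable_set_ltr => //; exact: measurableT_comp.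
  by rewrite -[X in lebesgue_rV n X]setIT -integral_indic.
(* Pairs (s, t) of a level and a volume below that of the superlevel set: read by rows it is the
   bathtub bound, by columns the rearrangement. *)
pose G : set (R * R) := [set p | [/\ (0 < p.1)%R, (0 < p.2)%R & p.2%:E < distribution_fun F p.1]].
have mG : measurable G.
  rewrite (_ : G = [set p | (0 < p.1)%R] `&` ([set p | (0 < p.2)%R] `&`
      [set p | p.2%:E < distribution_fun F p.1])); last first.
    by apply/seteqP; split => p; [move=> []|move=> [? []]].
  apply: measurableI; first exact: measurable_set_ltr.
  apply: measurableI; first exact: measurable_set_ltr.
  by apply: measurable_set_lte => //; exact: (measurableT_comp mlam).
pose g' (p : R * R) : \bar R := (p.2 `^ (n%:R^-1 - 1) * \1_G p)%:E.
have g'0 p : 0 <= g' p by rewrite lee_fin mulr_ge0// powR_ge0.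
have mg' : measurable_fun setT g'.
  apply/measurable_EFinP; apply: measurable_funM; last exact: measurable_indic.
  exact: (measurableT_comp (measurable_powR _)).
pose g (p : R * R) : \bar R := (Om `^ (1 - n%:R^-1))%:E * g' p.
have g0 p : 0 <= g p by rewrite mule_ge0// lee_fin powR_ge0.
have mg : measurable_fun setT g by exact: measurable_funeM.
apply: (@le_trans _ _ (\int[mu]_s \int[mu]_t g (s, t))).
  apply: ge0_integral_le => s _; first exact: integral_ge0.
  have [s0|s0] := leP s 0%R.
    rewrite [leLHS]integral0_eq; first exact: integral_ge0.
    move=> y _; rewrite /h/= indicE memNset ?mulr0// => -[/=].
    by rewrite ltNge s0.
  pose A := [set y | (s < F (z + y))%R].
  have mA : measurable A by exact: measurable_set_ltr.
  have AE : lebesgue_rV n A = distribution_fun F s.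
    have mB : measurable [set x | (s < `|F x|)%R].
      by apply: measurable_set_ltr => //; exact: measurableT_comp.
    have := lebesgue_rV_affine z ltr01 mB; rewrite expr1n invr1 mul1e => H; rewrite /distribution_fun -H.
    by congr (lebesgue_rV n _); apply/seteqP; split => y /=; rewrite scale1r ger0_norm.
  have -> : (fun y => h (y, s)) = (fun y => (\1_A y * kernel_rV y)%:E).
    apply/funext => y; rewrite /h/= mulrC !indicE; congr ((nat_of_bool _)%:R * _)%:E.
    by apply/idP/idP; rewrite !inE/=; [case|split].
  apply: le_trans (kernel_bathtub mA) _; rewrite AE.
  rewrite le_eqVlt; apply/orP; left; apply/eqP; apply: eq_integral => t _.
  rewrite /g /g' -EFinM mulrA; congr (_ * _)%:E; rewrite !indicE; congr ((nat_of_bool _)%:R).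
  by apply/idP/idP; rewrite !inE/= => -[]// *; split.
rewrite (fubini_tonelli (m1 := mu) (m2 := mu) g mg g0).
have mq := measurable_fun_fubini_tonelli_G (m1 := mu) g' mg' g'0.
pose q t := \int[mu]_s g' (s, t).
have q0 t : 0 <= q t by exact: integral_ge0.
have -> : \int[mu]_t \int[mu]_s g (s, t) = \int[mu]_t ((Om `^ (1 - n%:R^-1))%:E * q t).
  apply: eq_integral => t _; rewrite /g ge0_integralZl//; last by rewrite lee_fin powR_ge0.
  exact: (measurableT_comp mg' (measurable_pair2 t)).
rewrite ge0_integralZl//; last by rewrite lee_fin powR_ge0.
apply: lee_wpmul2l; first by rewrite lee_fin powR_ge0.
rewrite /lorentz_norm [leRHS]integral_mkcond; apply: ge0_integral_le => t _ //.
rewrite patchE; case: ifPn => [|/negP t0]; last first.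
  rewrite /q integral0_eq// => s _; rewrite /g'/= indicE memNset ?mulr0// => -[/= _ t0' _].
  by apply: t0; rewrite inE/= in_itv/= andbT.
rewrite inE/= in_itv/= andbT => t0.
have mGt : measurable [set s : R | G (s, t)].
  rewrite -[X in measurable X]setTI.
  exact: (measurable_pair2 t measurableT mG).
rewrite /q /g'/=.
rewrite (_ : (fun s => _) = (fun s => (t `^ (n%:R^-1 - 1) * \1_[set s : R | G (s, t)] s)%:E))//.
rewrite (integral_weight_indic mu (powR_ge0 _ _) mGt) powR_div//.
apply: lee_wpmul2l; first by rewrite lee_fin powR_ge0.
by apply: rearrangement_ge => // s [].
Qed.

End hardy_littlewood.

(** * Pointwise bound by a potential of the gradient *)

Section representation.
Context {R : realType} (n : nat) (n1 : (1 < n)%N).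
Notation mu := (@lebesgue_measure R).
Local Notation Om := (unit_ball_volume R n).
Local Open Scope ereal_scope.

Lemma continuous_eucl_norm_grad (f : 'rV[R]_n -> R) : C1 f ->
  continuous (fun x => eucl_norm (grad f x)).
Proof.
move=> [_ _ cd] x; apply: (@continuous_comp _ _ _ (grad f) (@eucl_norm R n)).
  apply: continuous_rV => i; under eq_fun do rewrite mxE; exact: cd.
exact: continuous_eucl_norm.
Qed.

(* Averaging the fundamental theorem of calculus along the rays through the
   unit ball. *)
Lemma C1_representation (f : 'rV[R]_n -> R) (M : R) (z : 'rV[R]_n) : C1 f -> supp_in M f ->
  (`|f z| * Om)%:E <= (n%:R^-1)%:E *
    \int[lebesgue_rV n]_y (eucl_norm (grad f (z + y)) * kernel_rV y)%:E.
Proof.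
move=> C1f sf.
pose F x := eucl_norm (grad f x).
have F0 x : (0 <= F x)%R by exact: eucl_norm_ge0.
have mF : measurable_fun setT F.
  exact: continuous_measurable_rV (continuous_eucl_norm_grad C1f).
have men := @measurable_eucl_norm R n.
have mFz : measurable_fun setT (fun y => F (z + y)%R).
  have := measurableT_comp mF (measurable_affine_rV z 1%R).
  by under eq_fun do rewrite /= scale1r.
pose D : set ('rV[R]_n * R) := [set p | (eucl_norm p.1 < 1)%R /\ (0 < p.2)%R].
have mD : measurable D.
  rewrite (_ : D = [set p | (eucl_norm p.1 < 1)%R] `&` [set p | (0 < p.2)%R])//.
  apply: measurableI; last exact: measurable_set_ltr.
  by apply: measurable_set_ltr => //; exact: (measurableT_comp men).
pose h (p : 'rV[R]_n * R) : \bar R := (F (z + p.2 *: p.1)%R * eucl_norm p.1 * \1_D p)%:E.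
have h0 p : 0 <= h p by rewrite lee_fin mulr_ge0// mulr_ge0// eucl_norm_ge0.
have mh : measurable_fun setT h.
  apply/measurable_EFinP; apply: measurable_funM; last exact: measurable_indic.
  apply: measurable_funM; last exact: (measurableT_comp men).
  apply: (measurableT_comp mFz); apply: measurable_fun_rV => i.
  under eq_fun do rewrite mxE; apply: measurable_funM => //.
  exact: (measurableT_comp (measurable_coord_rV i)).
(* Image of [h] under y = r w: the Jacobian gives r^(-n), the factor |w| = |y|/r one more power of
   1/r, and |w| < 1 becomes |y| < r. *)
pose H (p : 'rV[R]_n * R) : \bar R :=
  (F (z + p.1)%R * eucl_norm p.1 * (p.2 `^ (- n.+1%:R) * \1_[set p | (eucl_norm p.1 < p.2)%R] p))%:E.
have H0 p : 0 <= H p.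
  by rewrite lee_fin mulr_ge0// mulr_ge0// ?eucl_norm_ge0// powR_ge0.
have mE : measurable [set p : 'rV[R]_n * R | (eucl_norm p.1 < p.2)%R].
  by apply: measurable_set_ltr => //; exact: (measurableT_comp men).
have mH : measurable_fun setT H.
  apply/measurable_EFinP; apply: measurable_funM; apply: measurable_funM.
  - exact: (measurableT_comp mFz).
  - exact: (measurableT_comp men).
  - exact: (measurableT_comp (measurable_powR _)).
  - exact: measurable_indic.
have mB := measurable_eucl_ball (R := R) (n := n) 1%R.
have m0 : measurable [set (0%R : 'rV[R]_n)].
  have := measurable_box (R := R) (n := n) (I := fun=> [set 0%R]) (fun=> measurable_set1 _).
  congr measurable; apply/seteqP; split => [x /= x0|_ -> i /=]; last by rewrite mxE.
  by apply/rowP => i; rewrite x0 mxE.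
(* The ray with w = 0 never leaves the support; removing the origin does not change the volume. *)
have mB0 : measurable (eucl_ball 1%R `\ (0%R : 'rV[R]_n)) by exact: measurableD.
have B0E : lebesgue_rV n (eucl_ball 1%R `\ (0%R : 'rV[R]_n)) = Om%:E.
  rewrite measureD//; last exact: eucl_ball_finite.
  rewrite (_ : eucl_ball 1 `&` _ = [set 0%R]); last first.
    apply/seteqP; split => [x []//|_ ->]; split => //.
    by rewrite /eucl_ball/= eucl_norm0.
  by rewrite [X in _ - X](lebesgue_rV_point0 (ltnW n1)) sube0 unit_ball_volumeE.
rewrite EFinM -B0E -(integral_weight_indic _ (normr_ge0 (f z)) mB0).
apply: (@le_trans _ _ (\int[lebesgue_rV n]_w \int[mu]_r h (w, r))).
  apply: ge0_integral_le => w _; first by rewrite lee_fin mulr_ge0.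
  rewrite indicE; case: (boolP (w \in _)) => [|_]; last by rewrite mulr0; exact: integral_ge0.
  rewrite inE => -[w1 w0]; rewrite mulr1.
  have wn0 : (w != 0)%R by exact/eqP.
  apply: le_trans (C1_ray_bound z C1f sf wn0) _.
  rewrite -integral_itv_obnd_cbnd; last first.
    apply: measurable_funTS; apply/measurable_EFinP; apply: measurable_funM => //.
    apply: (measurableT_comp mFz); apply: measurable_fun_rV => i.
    by under eq_fun do rewrite mxE; apply: measurable_funM.
  rewrite integral_mkcond; apply: ge0_integral_le => r _.
    by apply: erestrict_ge0 => ? _; rewrite lee_fin mulr_ge0// eucl_norm_ge0.
  rewrite patchE; case: ifPn => // r0; rewrite /h/= indicE mem_set ?mulr1//.
  by split => //=; move: r0; rewrite inE/= in_itv/= andbT.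
rewrite (fubini_tonelli (m1 := lebesgue_rV n) (m2 := mu) h mh h0).
apply: (@le_trans _ _ (\int[mu]_r \int[lebesgue_rV n]_y H (y, r))).
  apply: ge0_integral_le => r _; first exact: integral_ge0.
  have [r0|r0] := leP r 0%R.
    rewrite [leLHS]integral0_eq; first exact: integral_ge0.
    by move=> w _; rewrite /h/= indicE memNset ?mulr0// => -[/= _]; rewrite ltNge r0.
  (* The factor r^n cancels the r^(-n) of the dilation formula. *)
  pose k y : \bar R := (r ^+ n)%:E * H (y, r).
  have mk : measurable_fun setT k.
    apply: measurable_funeM; exact: (measurableT_comp mH (measurable_pair2 r)).
  have k0 y : 0 <= k y by rewrite mule_ge0// lee_fin exprn_ge0// ltW.
  have -> : (fun w => h (w, r)) = (fun w => k (0 + r *: w)%R).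
    apply/funext => w; rewrite /k /H/= add0r eucl_normZ gtr0_norm// -EFinM.
    rewrite /h/= !indicE; congr EFin.
    have -> : ((w, r) \in D) = ((r *: w, r) \in [set p : 'rV[R]_n * R | (eucl_norm p.1 < p.2)%R]).
      have wE : (eucl_norm (r *: w)%R < r)%R = (eucl_norm w < 1)%R.
        by rewrite eucl_normZ gtr0_norm// gtr_pMr.
      apply/idP/idP; rewrite !inE /D/= wE; first by case.
      by move=> ?; split.
    have rn0 : (r ^+ n != 0)%R by rewrite gt_eqF// exprn_gt0.
    have rr0 : (r != 0)%R by rewrite gt_eqF.
    rewrite powRN powR_mulrn ?(ltW r0)// exprS; move: (_ \in _) => b.
    by field; rewrite rr0 rn0.
  rewrite (ge0_integral_rV_affine _ r0 mk k0) /k ge0_integralZl//; last 2 first.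
  - exact: (measurableT_comp mH (measurable_pair2 r)).
  - by rewrite lee_fin exprn_ge0// ltW.
  by rewrite muleA -EFinM mulVf ?mul1e// gt_eqF// exprn_gt0.
rewrite -(fubini_tonelli (m1 := lebesgue_rV n) (m2 := mu) H mH H0).
have mFk : measurable_fun setT (fun y => (F (z + y) * kernel_rV y)%:E).
  apply/measurable_EFinP; apply: measurable_funM => //; exact: measurable_kernel_rV.
have Fk0 y : setT y -> 0 <= (F (z + y) * kernel_rV y)%:E.
  by move=> _; rewrite lee_fin mulr_ge0// kernel_rV_ge0.
have nV0 : 0 <= (n%:R^-1 : R)%:E by rewrite lee_fin invr_ge0.
rewrite -(ge0_integralZl (lebesgue_rV n) measurableT mFk Fk0 nV0).
apply: ge0_integral_le => y _; first exact: integral_ge0.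
have [y0|y0] := eqVneq (eucl_norm y) 0%R.
  rewrite [leLHS]integral0_eq => [|r _]; last by rewrite /H/= y0 mulr0 mul0r.
  by rewrite -EFinM lee_fin !mulr_ge0// ?invr_ge0 ?eucl_norm_ge0 ?kernel_rV_ge0.
have y1 : (0 < eucl_norm y)%R by rewrite lt_def y0 eucl_norm_ge0.
have n0 : (n%:R != 0 :> R)%R by rewrite pnatr_eq0 -lt0n ltnW.
have n11 : (1 < n.+1)%N by rewrite ltnS ltnW.
(* The tail formula with n + 1 gives |y|^(-n) as the integral of [q]; multiplied by |y|/n it yields
   the kernel divided by n. *)
pose q (r : R) : R := (((n.+1)%:R - 1) * r `^ (- n.+1%:R) * \1_[set r | (eucl_norm y < r)%R] r)%R.
have mq : measurable_fun setT (fun r => (q r)%:E).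
  apply/measurable_EFinP; apply: measurable_funM; last first.
    by apply: measurable_indic; exact: measurable_set_ltr.
  by apply: measurable_funM => //; exact: measurable_powR.
have q0 r : 0 <= (q r)%:E.
  by rewrite lee_fin !mulr_ge0// ?powR_ge0// -natr1 addrK.
have -> : (fun r => H (y, r)) = (fun r => (F (z + y) * eucl_norm y / n%:R)%:E * (q r)%:E).
  apply/funext => r; rewrite /H /q -EFinM/=; congr EFin.
  have -> : \1_[set p : 'rV[R]_n * R | (eucl_norm p.1 < p.2)%R] (y, r) =
      (\1_[set r | (eucl_norm y < r)%R] r : R).
    by rewrite !indicE; congr ((nat_of_bool _)%:R); apply/idP/idP; rewrite !inE.
  move: (r `^ _)%R => P; rewrite -natr1 addrK.
  by field.
have k0 : 0 <= (F (z + y) * eucl_norm y / n%:R)%:E.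
  by rewrite lee_fin divr_ge0// mulr_ge0// ltW.
rewrite (ge0_integralZl mu measurableT mq (fun r _ => q0 r) k0).
rewrite (integral_tail_power n11 y1) -!EFinM lee_fin le_eqVlt; apply/orP; left; apply/eqP.
have -> : (kernel_rV y = eucl_norm y * eucl_norm y `^ (1 - n.+1%:R))%R.
  rewrite /kernel_rV -{2}[eucl_norm y]powRr1 ?eucl_norm_ge0// -powRD.
    by congr (_ `^ _)%R; rewrite -natr1; ring.
  by rewrite y0; apply/implyP.
by move: (_ `^ _)%R => P; ring.
Qed.

End representation.

(** * Smoothed cones *)

Section flat.
Context {R : realType} (a : R) (a0 : 0 < a).

(** For k = 0 this is the classical smooth function exp(-a/y) extended by 0. The powers y^(-k) make
    the family stable, up to linear combinations, under differentiation. *)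
Definition flat (k : nat) (y : R) : R :=
  if 0 < y then y ^- k * expR (- (a / y)) else 0.

Lemma flat_ge0 k y : 0 <= flat k y.
Proof.
rewrite /flat; case: ifPn => // y0.
by rewrite mulr_ge0 ?expR_ge0// invr_ge0 exprn_ge0// ltW.
Qed.

Lemma flat_le0 k y : y <= 0 -> flat k y = 0.
Proof. by rewrite /flat leNgt; case: ifPn. Qed.

(** From s^(k+2)/(k+2)! <= exp(s) at s = a/y. Quadratic decay is what a zero derivative at the
    origin calls for. *)
Lemma flat_le_sqr k y : flat k y <= (k.+2)`!%:R / a ^+ k.+2 * y ^+ 2.
Proof.
have [y0|y0] := leP y 0.
  by rewrite flat_le0// mulr_ge0 ?sqr_ge0// divr_ge0// exprn_ge0// ltW.
rewrite /flat y0 expRN.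
have ay0 : 0 < a / y by rewrite divr_gt0.
have h : (a / y) ^+ k.+2 / (k.+2)`!%:R <= expR (a / y).
  by rewrite (le_trans _ (expR_ge1Dxn k.+1 (ltW ay0)))// lerDr.
have f0 : 0 < (k.+2)`!%:R :> R by rewrite ltr0n fact_gt0.
have h0 : 0 < (a / y) ^+ k.+2 / (k.+2)`!%:R by rewrite divr_gt0// exprn_gt0.
apply: (@le_trans _ _ (y ^- k * ((a / y) ^+ k.+2 / (k.+2)`!%:R)^-1)).
  by rewrite ler_wpM2l ?invr_ge0 ?exprn_ge0 ?(ltW y0)// lef_pV2 ?posrE// expR_gt0.
rewrite le_eqVlt; apply/orP; left; apply/eqP.
have E2 (t : R) : t ^+ k.+2 = t * t * t ^+ k by rewrite 2!exprS mulrA.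
rewrite expr_div_n !E2.
have yk : y ^+ k != 0 by rewrite gt_eqF// exprn_gt0.
have ak : a ^+ k != 0 by rewrite gt_eqF// exprn_gt0.
have fn : (k.+2)`!%:R != 0 :> R by rewrite gt_eqF.
have yn : y != 0 by rewrite gt_eqF.
have an : a != 0 by rewrite gt_eqF.
move: fn yk ak; move: (y ^+ k) (a ^+ k) ((k.+2)`!%:R : R) => p q F Fn pn qn.
by field; rewrite pn qn yn an Fn.
Qed.

Lemma is_derive_flat k (y : R) :
  is_derive y 1 (flat k) (a * flat k.+2 y - k%:R * flat k.+1 y).
Proof.
have [y0|y0|->] := ltgtP y 0.
- rewrite !flat_le0 ?ltW// !mulr0 subr0.
  apply: (@near_eq_is_derive _ _ _ (cst 0)).
  near=> z; rewrite flat_le0// ltW//.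
  by near: z; apply: (open_nbhs_nbhs (conj (@open_lt R 0) y0)).
- apply: (@near_eq_is_derive R R^o R^o ((fun z : R => (z ^+ k)^-1) * (fun z : R => expR (- (a * z^-1))))%R).
    near=> z; rewrite /flat ifT//.
    by near: z; apply: (open_nbhs_nbhs (conj (@open_gt R 0) y0)).
  have yn : y != 0 by rewrite gt_eqF.
  have d1 : is_derive y (1 : R) (fun z : R => (z ^+ k)^-1) (- k%:R * y ^- k.+1).
    have dX : is_derive y (1 : R) (fun z : R => z ^+ k) (k%:R * y ^+ k.-1).
      apply: DeriveDef; first exact: exprn_derivable.
      by rewrite exp_derive /GRing.scale/= mulr1.
    have ykn : y ^+ k != 0 by rewrite expf_neq0.
    rewrite (_ : - k%:R * _ = - (y ^+ k) ^- 2 *: (k%:R * y ^+ k.-1)); first exact: is_deriveV.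
    rewrite /GRing.scale/=; case: (k) ykn => [|j] ykn.
      by rewrite !mul0r oppr0 mulr0 mul0r.
    have yj : y ^+ j != 0 by rewrite expf_neq0.
    have -> : y ^+ j.+2 = y * y * y ^+ j by rewrite 2!exprS mulrA.
    rewrite [y ^+ j.+1]exprS [j.+1.-1]/=.
    by move: (y ^+ j) yj (j.+1%:R : R) => P Pn c; field; rewrite yn Pn.
  have d2 : is_derive y (1 : R) (fun z : R => - (a * z^-1)) (a * y ^- 2).
    have dV := is_deriveV yn (is_derive_id y (1 : R)).
    apply: is_derive_eq.
    by rewrite /GRing.scale/= ?mulr1 ?mulrN ?mulNr ?opprK.
  have d3 : is_derive y (1 : R) (fun z : R => expR (- (a * z^-1)))
      (expR (- (a * y^-1)) * (a * y ^- 2)).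
    exact: (@is_derive1_comp _ expR (fun z => - (a * z^-1))).
  have d4 := is_deriveM d1 d3.
  apply: (is_derive_eq d4).
  rewrite /flat y0 /GRing.scale/=.
  move: (expR _) => e0.
  have yk : y ^+ k != 0 by rewrite expf_neq0.
  have -> : y ^+ k.+2 = y * y * y ^+ k by rewrite 2!exprS mulrA.
  rewrite [y ^+ k.+1]exprS.
  by move: (y ^+ k) yk => P Pn; field; rewrite yn Pn.
(* At the origin the quadratic bound makes the difference quotient at most C |h|. *)
- rewrite !flat_le0// !mulr0 subr0.
  suff H : h^-1 *: ((flat k \o shift 0) (h *: 1) - flat k 0) @[h --> 0^'] --> (0 : R).
    by split; [exact: cvgP H|exact: cvg_lim H].
  set C := (k.+2)`!%:R / a ^+ k.+2.
  have C0 : 0 <= C by rewrite divr_ge0// exprn_ge0// ltW.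
  apply/cvgr0Pnorm_le => e e0; near=> h.
  have h0 : h != 0 by near: h; exact: nbhs_dnbhs_neq.
  rewrite (flat_le0 _ (lexx 0)) subr0 /= [_ *: 1]mulr1 addr0 normrM normfV.
  rewrite (ger0_norm (flat_ge0 _ _)) mulrC ler_pdivrMr ?normr_gt0//.
  apply: (le_trans (flat_le_sqr _ _)); rewrite -/C -[h ^+ 2]real_normK ?num_real//.
  rewrite expr2 mulrA; apply: ler_wpM2r => //.
  have : `|h| <= e / (C + 1).
    near: h; apply: nbhs_dnbhs.
    exists (e / (C + 1)) => /=; first by rewrite divr_gt0// ltr_wpDl.
    by move=> z /=; rewrite sub0r normrN => /ltW.
  rewrite ler_pdivlMr ?ltr_wpDl// => he.
  by apply: le_trans he; rewrite mulrC ler_wpM2l// lerDl.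
Unshelve. all: by end_near. Qed.

Lemma continuous_flat k : continuous (flat k).
Proof.
move=> y; apply: differentiable_continuous; apply/derivable1_diffP.
by case: (is_derive_flat k y).
Qed.

End flat.

(** * An algebra of smooth functions containing the smoothed cone *)

Section bump.
Context {R : realType} (n : nat).
Variables (a d r : R) (x0 : 'rV[R]_n).
Hypotheses (a0 : 0 < a) (d0 : 0 < d).

(** A smooth substitute for |x - x0|, which is not differentiable at [x0]. It lies above |x - x0|,
    so a profile supported in soft norm < r is supported in B(x0, r). *)
Definition soft_norm (x : 'rV[R]_n) : R :=
  Num.sqrt (d ^+ 2 + \sum_i (x 0 i - x0 0 i) ^+ 2).

Lemma soft_norm_gt0 x : 0 < soft_norm x.
Proof.
by rewrite sqrtr_gt0 ltr_pwDl ?exprn_gt0// sumr_ge0// => i _; exact: sqr_ge0.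
Qed.

Lemma soft_normE x : soft_norm x ^+ 2 = d ^+ 2 + eucl_norm (x - x0) ^+ 2.
Proof.
rewrite sqr_sqrtr; last first.
  by rewrite addr_ge0 ?sqr_ge0// sumr_ge0// => i _; exact: sqr_ge0.
by rewrite eucl_norm_sqr; congr (_ + _); apply: eq_bigr => i _; rewrite !mxE.
Qed.

Lemma is_derive_comp_dir (V : normedModType R) (h : R -> R) (f : V -> R) (x w : V) (c : R) :
  derivable f x w -> is_derive (f x) (1 : R) h c -> is_derive x w (h \o f) (c * 'D_w f x).
Proof.
move=> df dh; apply: is_derive_line0.
have df0 : derivable f (0 *: w + x) w by rewrite scale0r add0r.
have := is_derive_line df0; rewrite [in X in is_derive _ _ _ X](_ : 0 *: w + x = x) => [H|];
  last by rewrite scale0r add0r.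
have dh0 : is_derive (f (0 *: w + x)) (1 : R) h c by rewrite scale0r add0r.
exact: (is_derive1_comp dh0 H).
Qed.

Lemma is_derive_coord (x : 'rV[R]_n) i j :
  is_derive x (delta_mx 0 j) (fun x : 'rV[R]_n => x 0 i) ((i == j)%:R : R).
Proof.
apply: is_derive_line0.
rewrite (_ : (fun s : R => _) = (fun s : R => (i == j)%:R * s + x 0 i)).
  apply: is_derive_eq.
  by rewrite addr0 /GRing.scale/= mulr1.
by apply/funext => s; rewrite !mxE ?eqxx/= mulrC.
Qed.

(* The algebra is stable under partial derivatives, whence smoothness. *)
Inductive bump_alg : ('rV[R]_n -> R) -> Prop :=
| bump_cst c : bump_alg (cst c)
| bump_coord i : bump_alg (fun x => x 0 i)
| bump_add f g : bump_alg f -> bump_alg g -> bump_alg (f + g)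
| bump_mul f g : bump_alg f -> bump_alg g -> bump_alg (f * g)
| bump_norm : bump_alg soft_norm
| bump_inv : bump_alg (fun x => (soft_norm x)^-1)
| bump_flat k : bump_alg (fun x => flat a k (r - soft_norm x)).

Lemma is_derive_soft_norm x j :
  is_derive x (delta_mx 0 j) soft_norm ((x 0 j - x0 0 j) / soft_norm x).
Proof.
pose q i (x : 'rV[R]_n) := (x 0 i - x0 0 i) ^+ 2.
have dq i : is_derive x (delta_mx 0 j) (q i) (2 * (x 0 i - x0 0 i) * (i == j)%:R).
  have dc := is_derive_coord x i j.
  have dB := is_deriveB dc (is_derive_cst (x0 0 i) x (delta_mx 0 j)).
  have dX := is_deriveX 2 dB.
  have -> : q i = ((fun x : 'rV[R]_n => x 0 i) - cst (x0 0 i)) ^+ 2 by apply/funext.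
  by apply: is_derive_eq; rewrite /GRing.scale/= subr0 expr1.
pose Q := cst (d ^+ 2) + \sum_(i < n) q i.
have dQ : is_derive x (delta_mx 0 j) Q (2 * (x 0 j - x0 0 j)).
  have := is_deriveD (is_derive_cst (d ^+ 2) x (delta_mx 0 j)) (is_derive_sum dq).
  rewrite add0r; congr is_derive.
  rewrite (bigD1 j)//= eqxx mulr1 big1 ?addr0// => i ij.
  by rewrite (negbTE ij) mulr0.
have QE z : Q z = d ^+ 2 + \sum_i (z 0 i - x0 0 i) ^+ 2.
  by rewrite /Q fctE/= fct_sumE.
have Q0 : 0 < Q x by rewrite QE -sqrtr_gt0; exact: soft_norm_gt0.
have -> : soft_norm = Num.sqrt \o Q by apply/funext => z; rewrite /= QE.
have dQx : derivable Q x (delta_mx 0 j) by case: dQ.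
have := is_derive_comp_dir dQx (is_derive1_sqrt Q0).
rewrite (@derive_val _ _ _ _ _ _ _ dQ) => H.
apply: (is_derive_eq H) => /=.
have sQ0 : Num.sqrt (Q x) != 0 by rewrite gt_eqF// sqrtr_gt0.
by field; rewrite sQ0.
Qed.

Lemma continuous_soft_norm : continuous soft_norm.
Proof.
move=> x; apply: (@continuous_comp _ _ _
  (fun x : 'rV[R]_n => d ^+ 2 + \sum_i (x 0 i - x0 0 i) ^+ 2) Num.sqrt).
  apply: (@continuousD _ _ _ (cst _) (fun x : 'rV[R]_n => \sum_i (x 0 i - x0 0 i) ^+ 2)).
    exact: cst_continuous.
  apply: continuous_big => [|i _ y]; first exact: add_continuous.
  apply: (@continuous_comp _ _ _ (fun x : 'rV[R]_n => x 0 i - x0 0 i) (fun t => t ^+ 2)).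
    by apply: continuousB; [exact: coord_continuous|exact: cst_continuous].
  exact: exprn_continuous.
exact: sqrt_continuous.
Qed.

Lemma bump_alg_continuous f : bump_alg f -> continuous f.
Proof.
elim=> [c|i|g h _ cg _ ch|g h _ cg _ ch|||k].
- exact: cst_continuous.
- exact: coord_continuous.
- by move=> x; apply: continuousD; [exact: cg|exact: ch].
- by move=> x; apply: continuousM; [exact: cg|exact: ch].
- exact: continuous_soft_norm.
- move=> x; apply: continuousV; first by rewrite gt_eqF// soft_norm_gt0.
  exact: continuous_soft_norm.
- move=> x; apply: (@continuous_comp _ _ _ (fun x => r - soft_norm x) (flat a k)).
    by apply: continuousB; [exact: cst_continuous|exact: continuous_soft_norm].
  exact: continuous_flat.
Qed.

(** The generators are chosen for this closure: differentiating the soft norm brings in its inverse,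
    and differentiating [flat a k] brings in the indices k + 1 and k + 2. *)
Lemma bump_alg_partial f j : bump_alg f ->
  exists2 g, bump_alg g & forall x, is_derive x (delta_mx 0 j) f (g x).
Proof.
have bcoef : bump_alg (fun x : 'rV[R]_n => (x 0 j - x0 0 j) / soft_norm x).
  apply: (@bump_mul (fun x => x 0 j - x0 0 j) (fun x => (soft_norm x)^-1)); last exact: bump_inv.
  by apply: (@bump_add (fun x => x 0 j) (cst (- x0 0 j))); [exact: bump_coord|exact: bump_cst].
elim=> [c|i|g h bg [g' bg' dg] bh [h' bh' dh]|g h bg [g' bg' dg] bh [h' bh' dh]|||k].
- by exists (cst 0); [exact: bump_cst|move=> x; exact: is_derive_cst].
- by exists (cst (i == j)%:R); [exact: bump_cst|move=> x; exact: is_derive_coord].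
- by exists (g' + h'); [exact: bump_add|move=> x; exact: is_deriveD].
- exists (g * h' + h * g'); first by apply: bump_add; exact: bump_mul.
  by move=> x; exact: is_deriveM.
- by exists (fun x : 'rV[R]_n => (x 0 j - x0 0 j) / soft_norm x) => // x; exact: is_derive_soft_norm.
- exists (cst (-1) * ((fun x => (soft_norm x)^-1) * ((fun x => (soft_norm x)^-1) *
    (fun x : 'rV[R]_n => (x 0 j - x0 0 j) / soft_norm x)))).
    by do 3 (apply: bump_mul => //; try exact: bump_cst; try exact: bump_inv).
  move=> x; have sn0 : soft_norm x != 0 by rewrite gt_eqF// soft_norm_gt0.
  have dV := @is_deriveV R id (soft_norm x) 1 1 sn0 (is_derive_id (soft_norm x) (1 : R)).
  have ds := is_derive_soft_norm x j.
  have dsx : derivable soft_norm x (delta_mx 0 j) by case: ds.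
  have := is_derive_comp_dir dsx dV.
  rewrite (@derive_val _ _ _ _ _ _ _ ds) => H.
  apply: (is_derive_eq H); rewrite /GRing.scale/= !fctE/=.
  by field; rewrite sn0.
- exists ((cst a * (fun x => flat a k.+2 (r - soft_norm x)) +
      cst (- k%:R) * (fun x => flat a k.+1 (r - soft_norm x))) *
      (cst (-1) * (fun x : 'rV[R]_n => (x 0 j - x0 0 j) / soft_norm x))).
    apply: bump_mul; last by apply: bump_mul => //; exact: bump_cst.
    by apply: bump_add; apply: bump_mul; (try exact: bump_cst); exact: bump_flat.
  move=> x; have ds := is_deriveB (is_derive_cst r x (delta_mx 0 j)) (is_derive_soft_norm x j).
  have dsx : derivable (cst r - soft_norm) x (delta_mx 0 j) by case: ds.
  have := is_derive_comp_dir dsx (is_derive_flat a0 k ((cst r - soft_norm) x)).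
  rewrite (@derive_val _ _ _ _ _ _ _ ds) => H.
  apply: (is_derive_eq H); rewrite !fctE/=.
  by ring.
Qed.

Lemma bump_alg_smooth f : bump_alg f -> smooth f.
Proof.
move=> bf s; have {bf} : bump_alg (foldr (@partial R n) f s).
  elim: s => //= i s /(bump_alg_partial i)[g bg dg].
  rewrite (_ : partial i _ = g)//; apply/funext => x; exact: derive_val.
move=> bg /=; split; first exact: bump_alg_continuous.
by move=> i x; have [g' _ dg] := bump_alg_partial i bg; case: (dg x).
Qed.

End bump.

(** * The smoothed cone and its gradient *)

Section bump_function.
Context {R : realType} (n : nat).

(* A smoothed cone: with [a] and [d] small it is close to [c (r - |x - x0|)]. *)
Definition bump (a d r c : R) (x0 x : 'rV[R]_n) : R :=
  c * ((r - soft_norm d x0 x) * flat a 0 (r - soft_norm d x0 x)).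

Section properties.
Variables (a d r c : R) (x0 : 'rV[R]_n).
Hypotheses (a0 : 0 < a) (d0 : 0 < d) (c0 : 0 < c) (r0 : 0 < r).
Notation sn := (soft_norm d x0).
Notation u := (bump a d r c x0).

Lemma smooth_bump : smooth u.
Proof.
have -> : u = cst c * ((cst r + cst (-1) * sn) * (fun x => flat a 0 (r - sn x))).
  by apply/funext => x; rewrite !fctE/= mulN1r.
apply: (bump_alg_smooth (a := a) (d := d) (r := r) (x0 := x0) a0 d0).
apply: bump_mul; first exact: bump_cst.
apply: bump_mul; last exact: bump_flat.
apply: bump_add; first exact: bump_cst.
by apply: bump_mul; [exact: bump_cst|exact: bump_norm].
Qed.

Lemma ler_soft_norm x : eucl_norm (x - x0) <= sn x.
Proof.
have h : eucl_norm (x - x0) ^+ 2 <= sn x ^+ 2 by rewrite soft_normE lerDr sqr_ge0.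
by move: h; rewrite ler_pXn2r// nnegrE ?eucl_norm_ge0// ltW// soft_norm_gt0.
Qed.

Lemma bump_out x : r <= eucl_norm (x - x0) -> r - sn x <= 0.
Proof. by move=> rx; rewrite subr_le0 (le_trans rx)// ler_soft_norm. Qed.

Lemma flat0_le1 y : flat a 0 y <= 1.
Proof.
rewrite /flat; case: ifPn => // y0; rewrite expr0 invr1 mul1r expR_le1 oppr_le0.
by rewrite divr_ge0// ltW.
Qed.

Lemma bump_ge0 x : 0 <= u x.
Proof.
have [w0|w0] := leP (r - sn x) 0; first by rewrite /bump flat_le0// !mulr0.
by rewrite mulr_ge0 ?(ltW c0)// mulr_ge0 ?flat_ge0// ltW.
Qed.

Lemma bump_le x : u x <= c * r.
Proof.
rewrite /bump ler_pM2l//; have [w0|w0] := leP (r - sn x) 0.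
  by rewrite flat_le0// mulr0 ltW.
rewrite -[leRHS]mulr1 ler_pM ?(ltW w0) ?flat_ge0 ?flat0_le1//.
by rewrite lerBlDr lerDl ltW// soft_norm_gt0.
Qed.

Lemma bump_eq0 x : r <= eucl_norm (x - x0) -> u x = 0.
Proof. by move=> /bump_out w0; rewrite /bump flat_le0// !mulr0. Qed.

Lemma bump_center : d < r -> u x0 = c * ((r - d) * expR (- (a / (r - d)))).
Proof.
move=> dr; have snd : sn x0 = d.
  rewrite /soft_norm big1 ?addr0 ?sqrtr_sqr ?gtr0_norm// => i _.
  by rewrite subrr expr0n.
by rewrite /bump snd /flat subr_gt0 dr expr0 invr1 mul1r.
Qed.

(** The derivative of the profile y exp(-a/y), that is (1 + a/y) exp(-a/y) for y > 0. *)
Definition bump_slope (y : R) := flat a 0 y + y * (a * flat a 2 y).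

(** This is 1 + s <= exp(s) at s = a/y. The profile y exp(-a/y) is thus never steeper than y itself:
    smoothing costs height at the vertex but leaves the slope at most [c]. *)
Lemma bump_slope_le1 y : bump_slope y <= 1.
Proof.
rewrite /bump_slope; have [y0|y0] := leP y 0; first by rewrite !flat_le0// !mulr0 addr0.
rewrite /flat y0 expr0 invr1 mul1r.
have -> : expR (- (a / y)) + y * (a * (y ^- 2 * expR (- (a / y)))) =
    (1 + a / y) * expR (- (a / y)).
  by move: (expR _) => E; field; rewrite gt_eqF.
by rewrite expRN ler_pdivrMr ?expR_gt0// mul1r expR_ge1Dx.
Qed.

Lemma bump_slope_ge0 y : 0 <= bump_slope y.
Proof.
have [y0|y0] := leP y 0; first by rewrite /bump_slope !flat_le0// !mulr0 addr0.
by rewrite addr_ge0 ?flat_ge0// mulr_ge0 ?(ltW y0)// mulr_ge0 ?flat_ge0// ltW.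
Qed.

Lemma partial_bump i x :
  partial i u x = - (c * bump_slope (r - sn x) / sn x) * (x 0 i - x0 0 i).
Proof.
pose h := cst c * (id * flat a 0) : R -> R.
have dh y : is_derive y (1 : R) h (c * bump_slope y).
  have dM := is_deriveM (is_derive_id y (1 : R)) (is_derive_flat a0 0 y).
  have dM' := is_deriveM (is_derive_cst c y (1 : R)) dM.
  apply: (is_derive_eq dM'); rewrite /bump_slope /GRing.scale/= !fctE/=.
  by rewrite mul0r subr0 mulr0 addr0 mulr1 addrC.
have ds := is_deriveB (is_derive_cst r x (delta_mx 0 i)) (is_derive_soft_norm x0 d0 x i).
have dsx : derivable (cst r - sn) x (delta_mx 0 i) by case: ds.
have := is_derive_comp_dir dsx (dh ((cst r - sn) x)).
rewrite (@derive_val _ _ _ _ _ _ _ ds) => H.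
rewrite /partial; have -> : u = h \o (cst r - sn) by apply/funext.
rewrite (@derive_val _ _ _ _ _ _ _ H) !fctE/=; ring.
Qed.

Lemma grad_bump x : grad u x = - (c * bump_slope (r - sn x) / sn x) *: (x - x0).
Proof. by apply/rowP => i; rewrite !mxE partial_bump. Qed.

(** Both factors are at most 1: the slope of the profile and the ratio of |x - x0| to the soft
    norm. *)
Lemma grad_bump_le x : eucl_norm (grad u x) <= c.
Proof.
rewrite grad_bump eucl_normZ normrN ger0_norm; last first.
  by rewrite divr_ge0 ?(ltW (soft_norm_gt0 _ _ _))// mulr_ge0 ?bump_slope_ge0// ltW.
have s0 := soft_norm_gt0 x0 d0 x.
rewrite mulrAC ler_pdivrMr// ler_pM ?eucl_norm_ge0 ?ler_soft_norm//.
  by rewrite mulr_ge0 ?bump_slope_ge0// ltW.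
by rewrite -[leRHS]mulr1 ler_pM2l// bump_slope_le1.
Qed.

Lemma grad_bump_eq0 x : r <= eucl_norm (x - x0) -> grad u x = 0.
Proof.
move=> /bump_out w0; rewrite grad_bump /bump_slope !flat_le0// !mulr0 addr0 mulr0 mul0r.
by rewrite oppr0 scale0r.
Qed.

Lemma test_function_bump : test_function u.
Proof.
split; first exact: smooth_bump.
pose K := [set x : 'rV[R]_n | forall i, `[x0 0 i - r, x0 0 i + r]%classic (x 0 i)].
have cK : compact K.
  by apply: (@rV_compact R n (fun i => `[x0 0 i - r, x0 0 i + r]%classic)) => i; exact: segment_compact.
have clK : closed K by apply: compact_closed => //; exact: norm_hausdorff.
apply: (subclosed_compact _ cK); first exact: closed_closure.
rewrite [X in _ `<=` X]((closure_id K).1 clK); apply: closure_subset => x /= ux i.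
rewrite /= in_itv/= -ler_distl; have := ler_coord_eucl_norm (x - x0) i.
rewrite !mxE => /le_trans; apply; rewrite leNgt; apply/negP => /ltW /bump_eq0 u0.
by move: ux; rewrite u0 eqxx.
Qed.

End properties.

Lemma smoothed_cone (r e : R) (x0 : 'rV[R]_n) : 0 < r -> 0 < e -> e < 1 ->
  exists u c, [/\ c = (r * (1 - e) ^+ 3)^-1, test_function u, 1 < u x0,
    forall x, `|u x| <= c * r * (eucl_norm (x - x0) < r)%R%:R &
    forall x, eucl_norm (grad u x) <= c * (eucl_norm (x - x0) < r)%R%:R].
Proof.
(* With these choices u(x0) = c r (1 - e) exp(-e) >= c r (1 - e)^2. The third factor 1 - e in [c]
   makes this bound 1/(1 - e), strictly above 1. *)
move=> r0 e0 e1; pose d := e * r; pose a := e * (r - d).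
have d0 : 0 < d by rewrite mulr_gt0.
have dr : d < r by rewrite gtr_pMl.
have rd0 : 0 < r - d by rewrite subr_gt0.
have a0 : 0 < a by rewrite mulr_gt0.
have e1' : 0 < 1 - e by rewrite subr_gt0.
pose c := (r * (1 - e) ^+ 3)^-1.
have c0 : 0 < c by rewrite invr_gt0 mulr_gt0// exprn_gt0.
exists (bump a d r c x0), c; split => //.
- exact: test_function_bump.
- rewrite bump_center// /a mulfK ?gt_eqF//.
  have he : 1 - e <= expR (- e) by exact: expR_ge1Dx.
  apply: (@lt_le_trans _ _ (c * ((r - d) * (1 - e)))); last first.
    by rewrite ler_pM2l// ler_pM2l.
  have -> : c * ((r - d) * (1 - e)) = (1 - e)^-1.
    by rewrite /c /d; field; rewrite !gt_eqF.
  by rewrite invf_gt1// gtrBl.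
- move=> x; case: ltP => xr; first by rewrite mulr1 ger0_norm ?bump_ge0// bump_le.
  by rewrite bump_eq0// normr0 mulr0.
- move=> x; case: ltP => xr; first by rewrite mulr1 grad_bump_le.
  by rewrite grad_bump_eq0// eucl_norm0 mulr0.
Qed.

End bump_function.

(** * Comparison of the two Lorentz norms *)

Section lorentz_norms.
Context {R : realType} (n : nat) (n1 : (1 < n)%N).
Notation mu := (@lebesgue_measure R).
Local Notation Om := (unit_ball_volume R n).
Local Open Scope ereal_scope.
Implicit Types f : 'rV[R]_n -> R.

Lemma rearrangement_nonincreasing f (s t : R) : (s <= t)%R ->
  rearrangement f t <= rearrangement f s.
Proof.
move=> st; apply: le_ereal_inf => _ [v [v0 vs] <-]; exists v => //; split => //.
by apply: le_trans vs _; rewrite lee_fin.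
Qed.

Lemma integral_cst_itv (x : \bar R) (t : R) : (0 < t)%R ->
  \int[mu]_(s in `]0%R, t[) cst x s = x * t%:E.
Proof.
move=> t0; rewrite integral_cst; last exact: measurable_itv.
congr (_ * _); change (mu `]0%R, t[%classic = t%:E).
by rewrite lebesgue_measure_itv/= lte_fin t0 sube0.
Qed.

(** A nonincreasing function is at most its mean over ]0, t[ at the right endpoint. *)
Lemma rearrangement_le_max f (t : R) : (0 < t)%R ->
  rearrangement f t <= max_rearrangement f t.
Proof.
move=> t0; rewrite /max_rearrangement.
have -> : rearrangement f t = (t^-1)%:E * \int[mu]_(s in `]0%R, t[) cst (rearrangement f t) s.
  by rewrite integral_cst_itv// muleCA -EFinM mulVf ?mule1// gt_eqF.
apply: lee_wpmul2l; first by rewrite lee_fin invr_ge0 ltW.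
apply: ge0_integral_le => s; first by move=> _; exact: rearrangement_ge0.
by rewrite /= in_itv/= => /andP[_ /ltW]; exact: rearrangement_nonincreasing.
Qed.

Lemma lorentz_norm_ge0 f : 0 <= lorentz_norm f.
Proof.
apply: integral_ge0 => t /=; rewrite in_itv/= andbT => t0.
by rewrite mule_ge0 ?rearrangement_ge0// lee_fin divr_ge0 ?powR_ge0// ltW.
Qed.

(** Approximation is measured in the larger norm, capacity in the smaller one; this inequality
    carries smallness from one to the other. *)
Lemma lorentz_norm_le_max f : lorentz_norm f <= lorentz_max_norm f.
Proof.
apply: ge0_integral_le => t /=; rewrite in_itv/= andbT => t0.
  by rewrite mule_ge0 ?rearrangement_ge0// lee_fin divr_ge0 ?powR_ge0// ltW.
apply: lee_wpmul2l; first by rewrite lee_fin divr_ge0 ?powR_ge0// ltW.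
exact: rearrangement_le_max.
Qed.

Lemma lorentz_max_norm_ge0 f : 0 <= lorentz_max_norm f.
Proof. exact: le_trans (lorentz_norm_ge0 f) (lorentz_norm_le_max f). Qed.

Let ninv0 : (0 < n%:R^-1 :> R)%R.
Proof. by rewrite invr_gt0 ltr0n ltnW. Qed.

Lemma integral_weight (m : R) : (0 < m)%R ->
  \int[mu]_(t in `]0%R, m[) (t `^ n%:R^-1 / t)%:E = (n%:R * m `^ n%:R^-1)%:E.
Proof.
move=> m0; rewrite -[X in (X * _)%:E]invrK mulrC -integral_powR_oo//.
by apply: eq_integral => t; rewrite inE/= in_itv/= => /andP[t0 _]; rewrite powR_div.
Qed.

Lemma measurable_weight (D : set R) : measurable D -> (forall t, D t -> (0 < t)%R) ->
  measurable_fun D (fun t => t `^ n%:R^-1 / t)%R.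
Proof.
move=> mD D0; apply: (@eq_measurable_fun _ _ _ _ _ (fun t : R => t `^ (n%:R^-1 - 1)))%R.
  by move=> t; rewrite inE => /D0 t0; rewrite powR_div.
by apply: measurable_funTS; exact: measurable_powR.
Qed.

(** A Chebyshev inequality: for t < m the rearrangement is at least [h], and the weight has integral
    n m^(1/n) over ]0, m[. *)
Lemma lorentz_norm_ge f (h m : R) : (0 <= h)%R -> (0 < m)%R ->
  (forall s, (0 <= s)%R -> (s < h)%R -> m%:E <= distribution_fun f s) ->
  (h * (n%:R * m `^ n%:R^-1))%:E <= lorentz_norm f.
Proof.
move=> h0 m0 hm.
have mw : measurable_fun (`]0%R, m[%classic : set R) (fun t => (t `^ n%:R^-1 / t)%:E).
  apply/measurable_EFinP; apply: measurable_weight; first exact: measurable_itv.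
  by move=> t; rewrite /= in_itv/= => /andP[].
have w0 (t : R) : `]0%R, m[%classic t -> 0 <= (t `^ n%:R^-1 / t)%:E.
  by rewrite /= in_itv/= => /andP[t0 _]; rewrite lee_fin divr_ge0 ?powR_ge0// ltW.
have h0' : 0 <= h%:E by rewrite lee_fin.
rewrite EFinM -integral_weight// -(ge0_integralZl mu (measurable_itv _) mw w0 h0').
rewrite integral_mkcond [leRHS]integral_mkcond; apply: ge0_integral_le => t _.
  apply: erestrict_ge0 => {}t; rewrite /= in_itv/= => /andP[t0 _].
  by rewrite mule_ge0// lee_fin divr_ge0 ?powR_ge0// ltW.
rewrite !patchE; case: ifPn => [|_]; last first.
  case: ifPn => //; rewrite inE/= in_itv/= andbT => t0.
  by rewrite mule_ge0 ?rearrangement_ge0// lee_fin divr_ge0 ?powR_ge0// ltW.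
rewrite inE/= in_itv/= => /andP[t0 tm].
rewrite ifT; last by rewrite inE/= in_itv/= t0.
rewrite muleC; apply: lee_wpmul2l; first by rewrite lee_fin divr_ge0 ?powR_ge0// ltW.
apply: le_ereal_inf_tmp => _ [v [v0 vt] <-]; rewrite lee_fin leNgt; apply/negP => vh.
by have := le_trans (hm _ v0 vh) vt; rewrite lee_fin leNgt tm.
Qed.

(** * Lorentz norms of bounded functions vanishing outside a ball *)

Section bounded_support.
Variables (f : 'rV[R]_n -> R) (M r : R) (x0 : 'rV[R]_n).
Hypotheses (mf : measurable_fun setT f) (M0 : (0 <= M)%R) (r0 : (0 < r)%R).
Hypothesis fM : forall x, (`|f x| <= M * (eucl_norm (x - x0) < r)%R%:R)%R.
Let V := (r ^+ n * Om)%R.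

Let V0 : (0 < V)%R.
Proof. by rewrite mulr_gt0 ?exprn_gt0// unit_ball_volume_gt0. Qed.

Lemma rearrangement_le_cst (t : R) : (0 < t)%R -> rearrangement f t <= M%:E.
Proof.
move=> t0; apply: ereal_inf_lbound; exists M => //; split => //.
rewrite /distribution_fun (_ : [set x | _] = set0) ?measure0 ?lee_fin ?ltW//.
apply/seteqP; split => // x /=; rewrite ltNge; apply/negP/negPn.
by apply: le_trans (fM x) _; rewrite ler_piMr// lern1 leq_b1.
Qed.

Lemma rearrangement_eq0 (t : R) : (V <= t)%R -> rearrangement f t <= 0.
Proof.
move=> Vt; apply: ereal_inf_lbound; exists 0%R => //; split => //.
apply: (@le_trans _ _ V%:E); last by rewrite lee_fin.
rewrite /V -eucl_ball_volume//.
have mB := measurable_eucl_ball (R := R) (n := n) r.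
have := lebesgue_rV_affine (- x0)%R ltr01 mB; rewrite expr1n invr1 mul1e => <-.
apply: le_measure; rewrite ?inE.
- by apply: measurable_set_ltr => //; exact: measurableT_comp.
- rewrite -[X in measurable X]setTI.
  exact: (measurable_affine_rV (- x0)%R 1%R measurableT mB).
- move=> x /=; rewrite /eucl_ball/= scale1r addrC => fx.
  have := lt_le_trans fx (fM x).
  by case: (eucl_norm _ < r)%R => //; rewrite mulr0 ltxx.
Qed.

(** The rearrangement is at most [M] and vanishes from the volume [V] of the ball on; the weight
    integrates over ]0, V[ to n V^(1/n) = n r Om^(1/n). *)
Lemma lorentz_norm_bounded_support :
  lorentz_norm f <= (M * (n%:R * (r * Om `^ n%:R^-1)))%:E.
Proof.
have -> : (r * Om `^ n%:R^-1 = V `^ n%:R^-1)%R.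
  rewrite powRM ?exprn_ge0 ?(ltW r0) ?(ltW (unit_ball_volume_gt0 n))//.
  by rewrite -powR_mulrn ?(ltW r0)// -powRrM mulfV ?powRr1 ?(ltW r0)// pnatr_eq0 -lt0n ltnW.
have mw : measurable_fun (`]0%R, V[%classic : set R) (fun t => (t `^ n%:R^-1 / t)%:E).
  apply/measurable_EFinP; apply: measurable_weight; first exact: measurable_itv.
  by move=> t; rewrite /= in_itv/= => /andP[].
have w0 (t : R) : `]0%R, V[%classic t -> 0 <= (t `^ n%:R^-1 / t)%:E.
  by rewrite /= in_itv/= => /andP[t0 _]; rewrite lee_fin divr_ge0 ?powR_ge0// ltW.
have M0' : 0 <= M%:E by rewrite lee_fin.
rewrite EFinM -integral_weight// -(ge0_integralZl mu (measurable_itv _) mw w0 M0').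
rewrite /lorentz_norm [leLHS]integral_mkcond [leRHS]integral_mkcond; apply: ge0_integral_le => t _.
  apply: erestrict_ge0 => {}t; rewrite /= in_itv/= andbT => t0.
  by rewrite mule_ge0 ?rearrangement_ge0// lee_fin divr_ge0 ?powR_ge0// ltW.
rewrite !patchE; case: ifPn => [|/negP t0]; last first.
  rewrite ifF//; apply/negP => tV; apply: t0; move: tV.
  by rewrite !inE/= !in_itv/= andbT => /andP[].
rewrite inE/= in_itv/= andbT => t0.
have {}w0 : 0 <= (t `^ n%:R^-1 / t)%:E by rewrite lee_fin divr_ge0 ?powR_ge0// ltW.
case: ifPn => [_|/negP tV].
  by rewrite [leRHS]muleC; apply: lee_wpmul2l => //; exact: rearrangement_le_cst.
rewrite -[leRHS](mule0 (t `^ n%:R^-1 / t)%:E); apply: lee_wpmul2l => //.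
apply: rearrangement_eq0; rewrite leNgt; apply/negP => tV'; apply: tV.
by rewrite inE/= in_itv/= t0.
Qed.

(** Being a mean, the maximal rearrangement need not vanish beyond [V]; it decays like V/t. *)
Lemma max_rearrangement_le (t : R) : (0 < t)%R ->
  max_rearrangement f t <= (M * Num.min 1 (V / t))%:E.
Proof.
move=> t0; rewrite /max_rearrangement.
apply: (@le_trans _ _ ((t^-1)%:E * (M * Num.min t V)%:E)); last first.
  rewrite -EFinM lee_fin mulrCA ler_wpM2l// minr_pMr ?invr_ge0 ?(ltW t0)//.
  by rewrite mulVf ?gt_eqF// mulrC.
apply: lee_wpmul2l; first by rewrite lee_fin invr_ge0 ltW.
have mV0 : (0 < Num.min t V)%R by rewrite lt_min t0 V0.
apply: (@le_trans _ _ (\int[mu]_(s in `]0%R, (Num.min t V)[) cst M%:E s)); last first.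
  by rewrite integral_cst_itv// -EFinM.
rewrite integral_mkcond [leRHS]integral_mkcond; apply: ge0_integral_le => s _.
  by apply: erestrict_ge0 => {}s _; exact: rearrangement_ge0.
rewrite !patchE; case: ifPn => [|/negP s0]; last first.
  rewrite ifF//; apply/negP => sV; apply: s0; move: sV.
  by rewrite !inE/= !in_itv/= lt_min => /andP[-> /andP[->]].
rewrite inE/= in_itv/= => /andP[s0 st].
case: ifPn => [_|/negP sV]; first exact: rearrangement_le_cst.
apply: rearrangement_eq0; rewrite leNgt; apply/negP => sV'; apply: sV.
by rewrite inE/= in_itv/= s0 lt_min st.
Qed.

Let tail_weight (t : R) : R := (t `^ n%:R^-1 / t * Num.min 1 (V / t))%R.

Let tail_weight_ge0 t : (0 < t)%R -> (0 <= tail_weight t)%R.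
Proof.
move=> t0; rewrite mulr_ge0// ?divr_ge0 ?powR_ge0 ?(ltW t0)//.
by rewrite le_min ler01 divr_ge0// ltW.
Qed.

(** Below [V] the integrand is at most t^(1/n-1), integrable at 0; above [V] it is at most V
    t^(1/n-2), integrable at infinity because n > 1. *)
Let integral_tail_weight : \int[mu]_(t in `]0%R, +oo[) (tail_weight t)%:E < +oo.
Proof.
pose f1 := (fun t : R => (t `^ n%:R^-1 / t)%:E) \_ `]0%R, V[.
pose f2 := (fun t : R => V%:E * (t `^ (n%:R^-1 - 1 - 1))%:E) \_ `[V, +oo[.
have f10 t : 0 <= f1 t.
  apply: erestrict_ge0 => {}t /=; rewrite in_itv/= => /andP[t0 _].
  by rewrite lee_fin divr_ge0 ?powR_ge0// ltW.
have f20 t : 0 <= f2 t.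
  apply: erestrict_ge0 => {}t _.
  by rewrite mule_ge0 ?lee_fin ?powR_ge0// ltW.
have m2 : measurable_fun (`[V, +oo[%classic : set R) (fun t : R => (t `^ (n%:R^-1 - 1 - 1))%:E).
  exact: measurable_powR_itv.
have a0 : (n%:R^-1 - 1 < 0 :> R)%R.
  by rewrite subr_lt0 invf_lt1 ?ltr1n// ltr0n ltnW.
apply: (@le_lt_trans _ _ (\int[mu]_t (f1 t + f2 t))).
  rewrite integral_mkcond; apply: ge0_integral_le => t _.
    apply: erestrict_ge0 => {}t /=; rewrite in_itv/= andbT => t0.
    by rewrite lee_fin tail_weight_ge0.
  rewrite patchE; case: ifPn => [|_]; last exact: adde_ge0.
  rewrite inE/= in_itv/= andbT => t0.
  have w0 : (0 <= t `^ n%:R^-1 / t)%R by rewrite divr_ge0 ?powR_ge0// ltW.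
  have [tV|Vt] := ltP t V.
    rewrite -[leLHS]adde0 leeD// /f1 patchE ifT; last by rewrite inE/= in_itv/= t0.
    by rewrite lee_fin -[leRHS]mulr1 ler_wpM2l// ge_min lexx.
  rewrite -[leLHS]add0e leeD// /f2 patchE ifT; last by rewrite inE/= in_itv/= Vt.
  rewrite -EFinM lee_fin; apply: (@le_trans _ _ (t `^ n%:R^-1 / t * (V / t))%R).
    by rewrite ler_wpM2l// ge_min lexx orbT.
  by rewrite -(powR_div _ t0) -(powR_div _ t0) mulrCA.
rewrite ge0_integralD//; last 2 first.
- apply/(measurable_restrictT _ _).1; first exact: measurable_itv.
  apply/measurable_EFinP; apply: measurable_weight; first exact: measurable_itv.
  by move=> t; rewrite /= in_itv/= => /andP[].
- apply/(measurable_restrictT _ _).1; first exact: measurable_itv.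
  exact: measurable_funeM.
have V0' : 0 <= V%:E by rewrite lee_fin ltW.
have p0 (t : R) : `[V, +oo[%classic t -> 0 <= (t `^ (n%:R^-1 - 1 - 1))%:E.
  by move=> _; rewrite lee_fin powR_ge0.
rewrite -!integral_mkcond integral_weight// (ge0_integralZl mu (measurable_itv _) m2 p0 V0').
by rewrite integral_powR_y// -EFinM -EFinD ltry.
Qed.

(** The factor [M] stays outside [K], so that M = 0 gives norm 0 for the zero function, while other
    values of [M] give finiteness. *)
Lemma lorentz_max_norm_bounded_support :
  exists K : R, lorentz_max_norm f <= (M * K)%:E.
Proof.
exists (fine (\int[mu]_(t in `]0%R, +oo[) (tail_weight t)%:E)).
have I0 : 0 <= \int[mu]_(t in `]0%R, +oo[) (tail_weight t)%:E.
  by apply: integral_ge0 => t /=; rewrite in_itv/= andbT lee_fin; exact: tail_weight_ge0.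
rewrite EFinM fineK ?ge0_fin_numE ?integral_tail_weight//.
have mI : measurable (`]0%R, +oo[%classic : set R) by exact: measurable_itv.
have mT : measurable_fun (`]0%R, +oo[%classic : set R) (EFin \o tail_weight).
  apply/measurable_EFinP; apply: measurable_funM.
    by apply: measurable_weight => // t; rewrite /= in_itv/= andbT.
  apply: measurable_minr => //; apply: measurable_funM => //.
  apply: (@eq_measurable_fun _ _ _ _ _ (fun t : R => t `^ (- 1)))%R.
    by move=> t; rewrite inE/= in_itv/= andbT => t0; rewrite powR_inv1// ltW.
  by apply: measurable_funTS; exact: measurable_powR.
have T0 (t : R) : `]0%R, +oo[%classic t -> 0 <= (EFin \o tail_weight) t.
  by rewrite /= in_itv/= andbT lee_fin; exact: tail_weight_ge0.
have M0' : 0 <= M%:E by rewrite lee_fin.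
rewrite -(ge0_integralZl mu mI mT T0 M0').
apply: ge0_integral_le => t /=; rewrite in_itv/= andbT => t0.
  rewrite mule_ge0// ?lee_fin ?divr_ge0 ?powR_ge0 ?(ltW t0)//.
  exact: le_trans (rearrangement_ge0 f t) (rearrangement_le_max f t0).
rewrite [leRHS]/= -EFinM /tail_weight mulrCA [leRHS]EFinM.
apply: lee_wpmul2l; first by rewrite lee_fin divr_ge0 ?powR_ge0// ltW.
exact: max_rearrangement_le.
Qed.

End bounded_support.

End lorentz_norms.

(** * The capacity of a point *)

Section capacity_of_a_point.
Context {R : realType} (n : nat) (n1 : (1 < n)%N).
Local Notation Om := (unit_ball_volume R n).
Local Open Scope ereal_scope.

Lemma lee_expe (x y : \bar R) k : 0 <= x -> x <= y -> x ^+ k <= y ^+ k.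
Proof.
move=> x0 xy; elim: k => [|k IH]; first by rewrite !expe0.
by rewrite !expeS lee_pmul// expe_ge0.
Qed.

Lemma test_function_supp_in (phi : 'rV[R]_n -> R) : test_function phi ->
  exists M, supp_in M phi.
Proof.
move=> [_ /compact_rV_sub_box[M hM]]; exists M => x i Mx.
apply: contrapT => phix; move: Mx; rewrite ltNge => /negP; apply.
by apply: hM; apply: subset_closure; exact/eqP.
Qed.

Let n0 : (0 < n%:R :> R)%R.
Proof. by rewrite ltr0n ltnW. Qed.

Let Om0 : (0 < Om)%R := unit_ball_volume_gt0 n.

(** The gradient of [phi] is written as [g] plus an error under the integral against the kernel,
    where the Euclidean triangle inequality applies pointwise; each piece then gets its own
    rearrangement bound. *)
Lemma sup_le_lorentz_norm (phi : 'rV[R]_n -> R) (g : 'rV[R]_n -> 'rV[R]_n) (z : 'rV[R]_n) :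
  test_function phi -> (forall i, measurable_fun setT (fun x => g x 0%R i)) ->
  (`|phi z| * (n%:R * Om `^ n%:R^-1))%:E <=
  lorentz_norm (@eucl_norm R n \o g) +
  lorentz_norm (@eucl_norm R n \o (fun x => grad phi x - g x)%R).
Proof.
move=> tphi mg; have C1phi := smooth_C1 tphi.1.
have [M sphi] := test_function_supp_in tphi.
pose F1 := @eucl_norm R n \o g; pose F2 := @eucl_norm R n \o (fun x => grad phi x - g x)%R.
have men := @measurable_eucl_norm R n.
have mF1 : measurable_fun setT F1 by apply: measurableT_comp => //; exact: measurable_fun_rV.
have mF2 : measurable_fun setT F2.
  apply: measurableT_comp => //; apply: measurable_fun_rV => i.
  have [_ _ cd] := C1phi.
  under eq_fun do rewrite !mxE; apply: measurable_funB => //.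
  exact: continuous_measurable_rV (cd i).
have F10 x : (0 <= F1 x)%R by exact: eucl_norm_ge0.
have F20 x : (0 <= F2 x)%R by exact: eucl_norm_ge0.
pose c := (Om `^ (1 - n%:R^-1))%R.
have c0 : (0 < c)%R by rewrite powR_gt0.
have mk := @measurable_kernel_rV R n.
have mz (F : 'rV[R]_n -> R) : measurable_fun setT F ->
    measurable_fun setT (fun y => (F (z + y)%R * kernel_rV y)%:E).
  move=> mF; apply/measurable_EFinP; apply: measurable_funM => //.
  have := measurableT_comp mF (measurable_affine_rV z 1%R).
  by under eq_fun do rewrite /= scale1r.
have key : (`|phi z| * Om)%:E <= (n%:R^-1 * c)%:E * (lorentz_norm F1 + lorentz_norm F2).
  apply: le_trans (C1_representation n1 z C1phi sphi) _.
  rewrite EFinM -muleA; apply: lee_wpmul2l; first by rewrite lee_fin invr_ge0 ltW.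
  rewrite ge0_muleDr ?lorentz_norm_ge0//.
  apply: le_trans; last exact: leeD (kernel_hardy_littlewood n1 z mF1 F10)
    (kernel_hardy_littlewood n1 z mF2 F20).
  have p1 y : setT y -> 0 <= (F1 (z + y)%R * kernel_rV y)%:E.
    by rewrite lee_fin mulr_ge0// kernel_rV_ge0.
  have p2 y : setT y -> 0 <= (F2 (z + y)%R * kernel_rV y)%:E.
    by rewrite lee_fin mulr_ge0// kernel_rV_ge0.
  rewrite -(ge0_integralD (lebesgue_rV n) measurableT p1 (mz _ mF1) p2 (mz _ mF2)).
  apply: ge0_integral_le => y _; first by rewrite lee_fin mulr_ge0// ?eucl_norm_ge0// kernel_rV_ge0.
  rewrite -EFinD lee_fin -mulrDl ler_wpM2r ?kernel_rV_ge0//.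
  by rewrite /F1 /F2/= -{1}[grad phi _](subrKC (g (z + y)%R)) ler_eucl_normD.
have := lorentz_norm_ge0 F1; have := lorentz_norm_ge0 F2.
move: key; rewrite -/F1 -/F2.
case: (lorentz_norm F1) => [r1| |] //; case: (lorentz_norm F2) => [r2| |] //;
  try by rewrite ?leey ?addye ?addey ?leey.
rewrite -EFinD -EFinM !lee_fin => key _ _.
(* [key] has Om in front of |phi(z)| and c/n in front of the norms; this identity gives the quotient
   Om / (c/n) = n Om^(1/n). *)
have OmE : (Om = c * Om `^ n%:R^-1)%R.
  by rewrite /c -powRD ?subrK ?powRr1 ?(ltW Om0)// (gt_eqF Om0) implybT.
have nc0 : (0 < n%:R^-1 * c)%R by rewrite mulr_gt0// invr_gt0.
rewrite -(ler_pM2l nc0); apply: le_trans key.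
suff -> : (n%:R^-1 * c * (`|phi z| * (n%:R * Om `^ n%:R^-1)) = `|phi z| * (c * Om `^ n%:R^-1))%R.
  by rewrite -OmE.
by move: (Om `^ n%:R^-1)%R => P; field; rewrite gt_eqF.
Qed.

(** A close enough test function exceeds 1 - e somewhere near [x]: otherwise it would differ from
    [u] by at least [e] almost everywhere on a set of positive measure, against the Chebyshev bound.
    The supremum estimate at such a point gives the claim up to errors that vanish with [e]. *)
Lemma admissible_lorentz_norm_ge (x : 'rV[R]_n) u g : admissible [set x] u g ->
  (n%:R * Om `^ n%:R^-1)%:E <= lorentz_norm (@eucl_norm R n \o g).
Proof.
move=> [[[[[mu_ _] ig _] _] happrox] [U [oU xU hU]]].
have Ux : U x by exact: xU.
have mg i : measurable_fun setT (fun x => g x 0%R i) by case: (ig i).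
set G := lorentz_norm _; have G0 : 0 <= G by exact: lorentz_norm_ge0.
case Gr : G G0 => [r| |] //; last by move=> _; rewrite leey.
rewrite lee_fin => r0.
(* Intersecting with a ball makes the measure finite, so that [m] is a positive real. *)
pose B := U `&` [set y | (eucl_norm (y - x) < 1)%R].
have oB : open B.
  apply: openI => //.
  have cn : continuous (fun y : 'rV[R]_n => eucl_norm (y - x)%R).
    move=> y; apply: (@continuous_comp _ _ _ (fun y : 'rV[R]_n => y - x)%R (@eucl_norm R n)).
      by apply: continuousB; [exact: cvg_id|exact: cst_continuous].
    exact: continuous_eucl_norm.
  by have /continuousP/(_ _ (@open_lt R 1)) := cn.
have Bx : B x by split => //=; rewrite subrr eucl_norm0.
have mB := open_measurable_rV oB.
have B0 := open_lebesgue_rV_gt0 oB Bx.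
have Bfin : lebesgue_rV n B < +oo.
  have mE := measurable_eucl_ball (R := R) (n := n) 1%R.
  have := lebesgue_rV_affine (- x)%R ltr01 mE; rewrite expr1n invr1 mul1e => E.
  apply: (@le_lt_trans _ _ (lebesgue_rV n (eucl_ball 1%R : set 'rV[R]_n))); last exact: eucl_ball_finite.
  rewrite -E; apply: le_measure; rewrite ?inE//.
  - rewrite -[X in measurable X]setTI.
    exact: (measurable_affine_rV (- x)%R 1%R measurableT mE).
  - by move=> y [_ /=]; rewrite /eucl_ball/= scale1r addrC.
pose m := fine (lebesgue_rV n B).
have mE : lebesgue_rV n B = m%:E by rewrite fineK// ge0_fin_numE.
have m0 : (0 < m)%R by rewrite -lte_fin -mE.
have step e : (0 < e)%R -> (e < 1)%R ->
    ((1 - e) * (n%:R * Om `^ n%:R^-1) <= r + e)%R.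
  move=> e0 e1.
  (* The second term is the Chebyshev lower bound for a difference of size [e] on [B]; the first
     controls the error on the gradient. *)
  pose e' := Num.min e (e * (n%:R * m `^ n%:R^-1))%R.
  have e'0 : (0 < e')%R by rewrite lt_min e0/= mulr_gt0// mulr_gt0// powR_gt0.
  have [phi tphi hphi] := happrox e' e'0.
  have h1 : lorentz_norm (fun y => phi y - u y)%R < e'%:E.
    apply: le_lt_trans hphi; apply: le_trans (lorentz_norm_le_max _) _.
    by rewrite leeDl// lorentz_max_norm_ge0.
  have h2 : lorentz_norm (@eucl_norm R n \o (fun y => grad phi y - g y)%R) < e'%:E.
    apply: le_lt_trans hphi; apply: le_trans (lorentz_norm_le_max _) _.
    by rewrite leeDr// lorentz_max_norm_ge0.
  have [z [_ hz]] : exists z, B z /\ (1 - e < phi z)%R.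
    apply: contrapT => nz.
    have phiB y : B y -> (phi y <= 1 - e)%R.
      by move=> By; rewrite leNgt; apply/negP => hy; apply: nz; exists y.
    have := lt_le_trans h1 (_ : e'%:E <= (e * (n%:R * m `^ n%:R^-1))%:E).
    rewrite lee_fin /e' ge_min lexx orbT => /(_ isT); apply/negP; rewrite -leNgt.
    apply: lorentz_norm_ge => //; first exact: ltW.
    move=> s s0 se; rewrite -mE /distribution_fun.
    have cphi : measurable_fun setT phi.
      by have [cp _ _] := smooth_C1 tphi.1; exact: continuous_measurable_rV cp.
    have mD : measurable [set y | (s < `|phi y - u y|)%R].
      by apply: measurable_set_ltr => //; apply: measurableT_comp => //; exact: measurable_funB.
    (* At a point of [B] outside the negligible set [N], phi <= 1 - e and u >= 1, so |phi - u| >= e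
       > s. *)
    case: hU => N [mN N0 UN].
    apply: (@le_trans _ _ (lebesgue_rV n ([set y | (s < `|phi y - u y|)%R] `|` N))).
      apply: le_measure; rewrite ?inE//; first exact: measurableU.
      move=> y By; have [uy|uy] := pselect (1 <= u y)%R; last first.
        by right; apply: UN => /= h; apply: uy; apply: h; case: By.
      left => /=; apply: lt_le_trans se _; rewrite distrC.
      apply: le_trans (ler_norm _); rewrite lerBrDl.
      by have := phiB y By; rewrite lerBrDr => /le_trans; apply.
    rewrite measureU0//.
  have := sup_le_lorentz_norm z tphi mg; rewrite -/G Gr => h3.
  have : ((1 - e) * (n%:R * Om `^ n%:R^-1))%:E <= (r + e)%:E.
    apply: (@le_trans _ _ (`|phi z| * (n%:R * Om `^ n%:R^-1))%:E).
      rewrite lee_fin ler_wpM2r// ?mulr_ge0 ?powR_ge0 ?(ltW n0)//.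
      exact: le_trans (ltW hz) (ler_norm _).
    apply: le_trans h3 _; rewrite EFinD leeD2l//; apply: ltW; apply: lt_le_trans h2 _.
    by rewrite lee_fin ge_min lexx.
  by rewrite lee_fin.
rewrite lee_fin; apply/ler_addgt0Pr => e e0.
set K := (n%:R * Om `^ n%:R^-1)%R in step *.
have K0 : (0 <= K)%R by rewrite mulr_ge0 ?powR_ge0// ltW.
have K1 : (0 < 1 + K)%R by rewrite ltr_pwDl.
(* Since t (1 + K) <= e, the inequality (1 - t) K <= r + t becomes K <= r + e. *)
pose t : R := (Num.min 2^-1 (e / (1 + K)))%R.
have t0 : (0 < t)%R by rewrite lt_min invr_gt0 ltr0n/= divr_gt0.
have t1 : (t < 1)%R by rewrite gt_min invf_lt1// ltr1n.
have te : (t * (1 + K) <= e)%R by rewrite -ler_pdivlMr// ge_min lexx orbT.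
by have := step t t0 t1; rewrite mulrBl mul1r lerBlDr => /le_trans; apply;
  rewrite -addrA lerD2l; apply: le_trans te; rewrite mulrDr mulr1.
Qed.

(** The function approximates itself with error 0, its classical gradient is the distributional one
    by parts, and the two pointwise bounds make its norm finite. Continuity turns [1 < u x0] into a
    bound on the open set where u > 1. *)
Lemma admissible_test_function (x0 : 'rV[R]_n) (u : 'rV[R]_n -> R) (c r : R) :
  test_function u -> (1 < u x0)%R -> (0 < r)%R -> (0 <= c)%R ->
  (forall x, `|u x| <= c * r * (eucl_norm (x - x0) < r)%R%:R)%R ->
  (forall x, eucl_norm (grad u x) <= c * (eucl_norm (x - x0) < r)%R%:R)%R ->
  admissible [set x0] u (grad u).
Proof.
move=> tu u1 r0 c0 hu hg.
have C1u := smooth_C1 tu.1; have [cu du cdu] := C1u.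
have gradE i : (fun x => grad u x 0%R i) = partial i u by apply/funext => x; rewrite mxE.
have loc f : continuous f -> loc_integrable f.
  move=> cf; split; first exact: continuous_measurable_rV.
  by move=> K cK; exact: continuous_compact_integrable_rV.
have approx : forall D : set ('rV[R]_n -> R), D u -> sobolev_approx D u (grad u).
  move=> D Du e e0; exists u => //.
  rewrite /sobolev_max_norm.
  have zero (f : 'rV[R]_n -> R) : (forall y, f y = 0%R) -> lorentz_max_norm f = 0.
    move=> f0; apply/eqP; rewrite eq_le lorentz_max_norm_ge0 andbT.
    have mf : measurable_fun setT f.
      by rewrite (_ : f = cst 0%R)//; apply/funext.
    have [|K] := lorentz_max_norm_bounded_support n1 (x0 := x0) (r := r) mf (lexx 0%R) r0.
      by move=> y; rewrite f0 normr0 mul0r.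
    by rewrite mul0r.
  rewrite !zero ?adde0 ?lte_fin// => y /=.
    by rewrite subrr eucl_norm0.
  by rewrite subrr.
split; last first.
  exists [set y | (1 < u y)%R]; split.
  - by have /continuousP/(_ _ (@open_gt R 1%R)) := cu.
  - by move=> _ ->.
  - by apply: aeW => y /= /ltW.
split; last exact: approx.
split.
  split.
  - exact: loc.
  - by move=> i; rewrite gradE; apply: loc; exact: cdu.
  - move=> phi i tphi; have [M sphi] := test_function_supp_in tphi.
    rewrite (integral_by_parts_rV i C1u (smooth_C1 tphi.1) sphi).
    by congr (- _); apply: eq_integral => y _; rewrite mxE.
apply: approx; split; first exact: tu.1.
have mu_ : measurable_fun setT u by exact: continuous_measurable_rV.
have mg : measurable_fun setT (@eucl_norm R n \o grad u).
  exact: continuous_measurable_rV (continuous_eucl_norm_grad C1u).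
have cr0 : (0 <= c * r)%R by rewrite mulr_ge0// ltW.
have [K1 hK1] := lorentz_max_norm_bounded_support n1 mu_ cr0 r0 hu.
have [|K2 hK2] := lorentz_max_norm_bounded_support n1 (x0 := x0) mg c0 r0.
  by move=> y /=; rewrite ger0_norm ?eucl_norm_ge0.
by apply: le_lt_trans (leeD hK1 hK2) _; rewrite -EFinD ltry.
Qed.

(** The cone of radius [e] with smoothing parameter [e]: the function contributes at most c e n e
    Om^(1/n), the gradient at most c n e Om^(1/n), and c e = (1 - e)^(-3). *)
Lemma capacity_le (x0 : 'rV[R]_n) (e : R) : (0 < e)%R -> (e < 1)%R ->
  capacity [set x0] <=
  (((1 + e) / (1 - e) ^+ 3 * (n%:R * Om `^ n%:R^-1)) ^+ n)%:E.
Proof.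
move=> e0 e1.
have [u [c [cE tu u1 hu hg]]] := smoothed_cone x0 e0 e0 e1.
have e1' : (0 < 1 - e)%R by rewrite subr_gt0.
have c0 : (0 <= c)%R by rewrite cE invr_ge0 mulr_ge0 ?exprn_ge0// ltW.
have C1u := smooth_C1 tu.1; have [cu _ _] := C1u.
have mu_ : measurable_fun setT u by exact: continuous_measurable_rV.
have mg : measurable_fun setT (@eucl_norm R n \o grad u).
  exact: continuous_measurable_rV (continuous_eucl_norm_grad C1u).
have ce0 : (0 <= c * e)%R by rewrite mulr_ge0// ltW.
apply: (@le_trans _ _ (sobolev_norm u (grad u) ^+ n)).
  apply: ereal_inf_lbound; exists u, (grad u); split => //.
  exact: admissible_test_function hu hg.
rewrite EFin_expe.
have h1 := lorentz_norm_bounded_support n1 mu_ ce0 e0 hu.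
have h2 := lorentz_norm_bounded_support n1 (f := @eucl_norm R n \o grad u) (x0 := x0) mg c0 e0.
have {}h2 := h2 (fun y => ltac:(rewrite /= ger0_norm ?eucl_norm_ge0//; exact: hg)).
have H : sobolev_norm u (grad u) <=
    ((1 + e) / (1 - e) ^+ 3 * (n%:R * Om `^ n%:R^-1))%:E.
  apply: le_trans (leeD h1 h2) _; rewrite -EFinD lee_fin le_eqVlt; apply/orP; left; apply/eqP.
  by rewrite cE; move: (Om `^ _)%R => P; field; rewrite !gt_eqF.
have s0 : 0 <= sobolev_norm u (grad u) by rewrite adde_ge0// lorentz_norm_ge0.
exact: lee_expe.
Qed.

Let K : R := (n%:R * Om `^ n%:R^-1)%R.

Lemma capacity_point_le (x0 : 'rV[R]_n) : capacity [set x0] <= (K ^+ n)%:E.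
Proof.
pose h (e : R) := (((1 + e) / (1 - e) ^+ 3 * K) ^+ n)%R.
have hle e : (0 < e)%R -> (e < 1)%R -> capacity [set x0] <= (h e)%:E by exact: capacity_le.
have hcvg : h e @[e --> (0:R)^'+] --> (K ^+ n)%R.
  have -> : (K ^+ n = h 0)%R by rewrite /h addr0 subr0 expr1n invr1 !mul1r.
  apply: cvg_at_right_filter.
  pose k (e : R) := ((1 + e) / (1 - e) ^+ 3 * K)%R.
  apply: (@continuous_comp _ _ _ k (fun x => x ^+ n)%R); last exact: exprn_continuous.
  apply: (@continuousM _ _ (fun e : R => (1 + e) / (1 - e) ^+ 3)%R (cst K)); last exact: cst_continuous.
  apply: (@continuousM _ _ (fun e : R => 1 + e)%R (fun e : R => ((1 - e) ^+ 3)^-1)%R).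
    by apply: (@cvgD _ R^o); [exact: cvg_cst|exact: cvg_id].
  apply: (@continuousV _ _ (fun e : R => (1 - e) ^+ 3)%R); first by rewrite subr0 expr1n oner_neq0.
  apply: (@continuous_comp _ _ _ (fun e : R => 1 - e)%R (fun x => x ^+ 3)%R).
    by apply: (@cvgB _ R^o); [exact: cvg_cst|exact: cvg_id].
  exact: exprn_continuous.
have c0 : 0 <= capacity [set x0].
  apply: le_ereal_inf_tmp => _ [u [g [_ ->]]].
  by rewrite expe_ge0// adde_ge0// lorentz_norm_ge0.
(* The bound at e = 1/2 excludes the value [+oo], so that the limit is taken among reals. *)
have half0 : (0 < 2^-1 :> R)%R by rewrite invr_gt0.
have half1 : (2^-1 < 1 :> R)%R by rewrite invf_lt1// ltr1n.
case: (capacity [set x0]) c0 hle => [r| |] // _ hle; last first.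
  by have := hle _ half0 half1; rewrite leye_eq.
rewrite lee_fin -(cvg_lim _ hcvg)//; apply: limr_ge; first exact: cvgP hcvg.
near=> e; rewrite -lee_fin; apply: hle.
- by near: e; exact: nbhs_right_gt.
- by near: e; exact: nbhs_right_lt.
Unshelve. all: by end_near. Qed.

(** The gradient alone accounts for the bound; the norm of [u] is merely nonnegative. *)
Lemma capacity_point_ge (x0 : 'rV[R]_n) : (K ^+ n)%:E <= capacity [set x0].
Proof.
apply: le_ereal_inf_tmp => _ [u [g [adm ->]]].
rewrite EFin_expe; apply: lee_expe; first by rewrite lee_fin mulr_ge0 ?powR_ge0// ltW.
apply: le_trans (admissible_lorentz_norm_ge adm) _.
by rewrite leeDr// lorentz_norm_ge0.
Qed.

Lemma capacity_pointE (x0 : 'rV[R]_n) :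
  capacity [set x0] = (n%:R ^+ n * Om)%:E.
Proof.
have -> : (n%:R ^+ n * Om = K ^+ n)%R.
  rewrite exprMn -[in RHS](powR_mulrn n (powR_ge0 _ _)) -powRrM mulVf ?gt_eqF//.
  by rewrite powRr1// ltW.
by apply/eqP; rewrite eq_le capacity_point_le capacity_point_ge.
Qed.

End capacity_of_a_point.

Theorem theorem6p3 (R : realType) (n : nat) (hn : (2 <= n)%N) (x : 'rV[R]_n) :
  capacity [set x] = (n%:R ^+ n * unit_ball_volume R n)%:E /\
  0 < n%:R ^+ n * unit_ball_volume R n.
Proof.
split; first exact: capacity_pointE.
by rewrite mulr_gt0 ?unit_ball_volume_gt0// exprn_gt0// ltr0n ltnW.
Qed.
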